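(* Let $\mathfrak{A}$ be a fusion ring with fusion coefficients $N_{k,j}^i$ and fusion matrices $M_k=(N_{k,j}^i)_{i,j}$, $1\le i,j,k\le n$. If $\mathfrak{A}$ admits a unitary categorification, then for any $v\in\mathbb{C}^n$, $$\sum_{k=1}^n\frac{v^*M_kv}{\|M_k\|}\,M_k\otimes M_k\ \ge\ 0,$$ i.e. this $n^2\times n^2$ matrix is positive semidefinite.
   Context: A fusion ring $\mathfrak{A}$ is given with its distinguished basis $\{x_1=I,x_2,\dots,x_n\}$, its involution $x_k\mapsto x_k^*=x_{k^*}$, and the fusion rules $x_kx_j=\sum_{i=1}^n N_{k,j}^i x_i$ with $N_{k,j}^i\in\mathbb{N}$ (nonnegative integers), $N_{k,j}^1=\delta_{k,j^*}$. The fusion matrix $M_k$ has $(i,j)$ entry $N_{k,j}^i$, and $\|M_k\|$ is its operator norm. $\mathfrak{A}$ admits a unitary categorification if it is isomorphic, as a ring with distinguished basis, to the Grothendieck ring of a unitary fusion category (with the basis of classes of simple objects). *)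

(* Defs.v *)
From mathcomp Require Import all_boot all_order all_algebra.
From mathcomp Require Import complex mxtens.
From mathcomp Require Import boolp classical_sets reals.

Set Implicit Arguments.
Unset Strict Implicit.
Unset Printing Implicit Defensive.

Import Order.TTheory GRing.Theory Num.Theory.
Local Open Scope ring_scope.
Local Open Scope complex_scope.
Local Open Scope sesquilinear_scope.

Section ComplexMatrices.
Variable R : realType.

Definition l2norm n (u : 'cV[R[i]]_n) : R :=
  Num.sqrt (complex.Re ((u^t* *m u) 0 0)).

Definition opnorm m n (A : 'M[R[i]]_(m, n)) : R :=
  sup [set l2norm (A *m u) | u in [set u : 'cV[R[i]]_n | l2norm u <= 1]].

(* In the order of [R[i]], [0 <= z] means that [z] is real and nonnegative, so
   this condition forces [A] to be Hermitian. *)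
Definition possemidef n (A : 'M[R[i]]_n) : Prop :=
  forall u : 'cV[R[i]]_n, 0 <= (u^t* *m A *m u) 0 0.

End ComplexMatrices.

(* The rank is [n.+1]; index [ord0] stands for the index 1 of the unit.
   [fusion_coef k j i] is the coefficient N_{k,j}^i of x_i in x_k x_j. *)

Record fusion_ring (n : nat) := FusionRing {
  fusion_carrier :> nzRingType;
  fusion_basis : 'I_n.+1 -> fusion_carrier;
  fusion_dual : 'I_n.+1 -> 'I_n.+1;
  fusion_coef : 'I_n.+1 -> 'I_n.+1 -> 'I_n.+1 -> nat;
  fusion_basisP : forall a : fusion_carrier,
    exists! c : {ffun 'I_n.+1 -> int}, a = \sum_i fusion_basis i *~ c i;
  fusion_unit : fusion_basis ord0 = 1;
  fusion_rule : forall k j,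
    fusion_basis k * fusion_basis j
    = \sum_i fusion_basis i *+ fusion_coef k j i;
  fusion_dualK : involutive fusion_dual;
  (* The additive extension of [x_k |-> x_{k^*}] reverses products. *)
  fusion_dualM : forall k j i,
    fusion_coef (fusion_dual j) (fusion_dual k) (fusion_dual i)
    = fusion_coef k j i;
  fusion_coef_unit : forall k j,
    fusion_coef k j ord0 = (k == fusion_dual j) :> nat
}.

Definition fusion_mx (R : realType) n (A : fusion_ring n) (k : 'I_n.+1) :
    'M[R[i]]_n.+1 :=
  \matrix_(i, j) (fusion_coef A k j i)%:R.

Record lin_category (K : fieldType) := LinCategory {
  obj :> Type;
  hom : obj -> obj -> vectType K;
  idm : forall X, hom X X;
  comp : forall X Y Z, hom Y Z -> hom X Y -> hom X Z;
  comp_idl : forall X Y (f : hom X Y), comp (idm Y) f = f;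
  comp_idr : forall X Y (f : hom X Y), comp f (idm X) = f;
  compA : forall W X Y Z (h : hom Y Z) (g : hom X Y) (f : hom W X),
    comp h (comp g f) = comp (comp h g) f;
  comp_linear_r : forall X Y Z (g : hom Y Z), linear (fun f : hom X Y => comp g f);
  comp_linear_l : forall X Y Z (f : hom X Y), linear (fun g : hom Y Z => comp g f)
}.

Arguments hom {K l} X Y.
Arguments idm {K l} X.
Arguments comp {K l X Y Z} g f.
Notation "g \c f" := (comp g f) (at level 50, left associativity, only parsing).

Section LinCategoryTheory.
Variables (K : fieldType) (C : lin_category K).
Implicit Types X Y Z W : C.

Definition is_iso X Y (f : hom X Y) : Prop :=
  exists g : hom Y X, g \c f = idm X /\ f \c g = idm Y.

Definition isomorphic X Y : Prop := exists f : hom X Y, is_iso f.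

Definition mono X Y (f : hom X Y) : Prop :=
  forall W (g h : hom W X), f \c g = f \c h -> g = h.

Definition epi X Y (f : hom X Y) : Prop :=
  forall W (g h : hom Y W), g \c f = h \c f -> g = h.

Definition is_kernel X Y Z (k : hom X Y) (f : hom Y Z) : Prop :=
  f \c k = 0 /\
  forall W (g : hom W Y), f \c g = 0 -> exists! h : hom W X, g = k \c h.

Definition is_cokernel X Y Z (q : hom Y Z) (f : hom X Y) : Prop :=
  q \c f = 0 /\
  forall W (g : hom Y W), g \c f = 0 -> exists! h : hom Z W, g = h \c q.

(* [X] is a direct sum (biproduct) of the family [F]; for an empty [I] this
   says that [X] is a zero object. *)
Definition direct_sum (I : finType) (F : I -> C) X : Prop :=
  exists (inj : forall t, hom (F t) X) (prj : forall t, hom X (F t)),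
    [/\ forall t, prj t \c inj t = idm (F t),
        forall s t, s != t -> prj s \c inj t = 0
      & \sum_t (inj t \c prj t) = idm X].

Definition abelian_category : Prop :=
  [/\ forall n (F : 'I_n -> C), exists X, direct_sum F X,
      forall X Y (f : hom X Y), exists W (k : hom W X), is_kernel k f,
      forall X Y (f : hom X Y), exists W (q : hom Y W), is_cokernel q f,
      forall X Y (f : hom X Y), mono f ->
        exists Z (g : hom Y Z), is_kernel f g
    & forall X Y (f : hom X Y), epi f ->
        exists W (g : hom W X), is_cokernel f g].

Definition simple_obj X : Prop :=
  idm X <> 0 /\ forall Y (f : hom Y X), mono f -> f = 0 \/ is_iso f.

Definition semisimple_category : Prop :=
  forall X, exists n (F : 'I_n -> C),
    (forall t, simple_obj (F t)) /\ direct_sum F X.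

Definition finitely_many_simples : Prop :=
  exists n (F : 'I_n -> C),
    forall X, simple_obj X -> exists t, isomorphic X (F t).

Definition simple_representatives n (S : 'I_n -> C) : Prop :=
  [/\ forall t, simple_obj (S t),
      forall s t, isomorphic (S s) (S t) -> s = t
    & forall X, simple_obj X -> exists t, isomorphic X (S t)].

(* [X] is a direct sum of [m t] copies of [S t], for all [t]. *)
Definition multiplicities n (S : 'I_n -> C) X (m : 'I_n -> nat) : Prop :=
  direct_sum (fun p : {t : 'I_n & 'I_(m t)} => S (tag p)) X.

End LinCategoryTheory.

Record tens_category (K : fieldType) := TensCategory {
  tens_base :> lin_category K;
  tens_unit : tens_base;
  tens : tens_base -> tens_base -> tens_base;
  tensm : forall X X' Y Y' : tens_base,
    hom X X' -> hom Y Y' -> hom (tens X Y) (tens X' Y');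
  tensm_id : forall X Y, tensm (idm X) (idm Y) = idm (tens X Y);
  tensm_comp : forall (X X' X'' Y Y' Y'' : tens_base)
      (f' : hom X' X'') (f : hom X X') (g' : hom Y' Y'') (g : hom Y Y'),
    tensm (f' \c f) (g' \c g) = tensm f' g' \c tensm f g;
  tensm_linear_r : forall (X X' Y Y' : tens_base) (f : hom X X'),
    linear (fun g : hom Y Y' => tensm f g);
  tensm_linear_l : forall (X X' Y Y' : tens_base) (g : hom Y Y'),
    linear (fun f : hom X X' => tensm f g);
  assoc : forall X Y Z, hom (tens (tens X Y) Z) (tens X (tens Y Z));
  assocV : forall X Y Z, hom (tens X (tens Y Z)) (tens (tens X Y) Z);
  assocK : forall X Y Z, assocV X Y Z \c assoc X Y Z = idm _;
  assocVK : forall X Y Z, assoc X Y Z \c assocV X Y Z = idm _;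
  assoc_natural : forall (X X' Y Y' Z Z' : tens_base)
      (f : hom X X') (g : hom Y Y') (h : hom Z Z'),
    assoc X' Y' Z' \c tensm (tensm f g) h
    = tensm f (tensm g h) \c assoc X Y Z;
  lunit : forall X, hom (tens tens_unit X) X;
  lunit_iso : forall X, is_iso (lunit X);
  lunit_natural : forall (X X' : tens_base) (f : hom X X'),
    lunit X' \c tensm (idm tens_unit) f = f \c lunit X;
  runit : forall X, hom (tens X tens_unit) X;
  runit_iso : forall X, is_iso (runit X);
  runit_natural : forall (X X' : tens_base) (f : hom X X'),
    runit X' \c tensm f (idm tens_unit) = f \c runit X;
  pentagon : forall W X Y Z,
    assoc W X (tens Y Z) \c assoc (tens W X) Y Z
    = tensm (idm W) (assoc X Y Z) \c assoc W (tens X Y) Z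
      \c tensm (assoc W X Y) (idm Z);
  triangle : forall X Y,
    tensm (idm X) (lunit Y) \c assoc X tens_unit Y = tensm (runit X) (idm Y)
}.

Arguments tens_unit {K t}.
Arguments tens {K t} X Y.
Arguments tensm {K t X X' Y Y'} f g.
Arguments assoc {K t} X Y Z.
Arguments assocV {K t} X Y Z.
Arguments lunit {K t} X.
Arguments runit {K t} X.

Section FusionCategory.
Variables (K : fieldType) (C : tens_category K).
Implicit Types X Y : C.

(* [Y] is a left dual of [X], equivalently [X] is a right dual of [Y]. *)
Definition left_dual X Y : Prop :=
  exists (ev : hom (tens Y X) tens_unit) (coev : hom tens_unit (tens X Y)),
    runit X \c tensm (idm X) ev \c assoc X Y X \c tensm coev (idm X) = lunit X
    /\
    lunit Y \c tensm ev (idm Y) \c assocV Y X Y \c tensm (idm Y) coev = runit Y.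

Definition rigid_category : Prop :=
  forall X, (exists Y, left_dual X Y) /\ (exists Y, left_dual Y X).

Definition is_fusion_category : Prop :=
  [/\ abelian_category C,
      semisimple_category C /\ finitely_many_simples C,
      rigid_category
    & \dim {:hom (tens_unit : C) tens_unit} = 1%N].

End FusionCategory.

(* A C*-tensor category: the spaces of morphisms are finite-dimensional, so
   their completeness for [hnorm] is automatic. *)

Record unitary_structure (R : realType) (C : tens_category R[i]) :=
    UnitaryStructure {
  star : forall X Y : C, hom X Y -> hom Y X;
  star_antilinear : forall (X Y : C) (a : R[i]) (f g : hom X Y),
    star (a *: f + g) = a^* *: star f + star g;
  starK : forall (X Y : C) (f : hom X Y), star (star f) = f;
  star_comp : forall (X Y Z : C) (g : hom Y Z) (f : hom X Y),
    star (g \c f) = star f \c star g;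
  hnorm : forall X Y : C, hom X Y -> R;
  hnorm_triangle : forall (X Y : C) (f g : hom X Y),
    hnorm (f + g) <= hnorm f + hnorm g;
  hnormZ : forall (X Y : C) (a : R[i]) (f : hom X Y),
    (hnorm (a *: f))%:C = `|a| * (hnorm f)%:C;
  hnorm0_eq0 : forall (X Y : C) (f : hom X Y), hnorm f = 0 -> f = 0;
  hnorm_comp : forall (X Y Z : C) (g : hom Y Z) (f : hom X Y),
    hnorm (g \c f) <= hnorm g * hnorm f;
  hnorm_star : forall (X Y : C) (f : hom X Y),
    hnorm (star f \c f) = hnorm f ^+ 2;
  (* [f^* f] is a positive element of the C*-algebra [hom X X]. *)
  star_positive : forall (X Y : C) (f : hom X Y),
    exists g : hom X X, star f \c f = star g \c g;
  star_tensm : forall (X X' Y Y' : C) (f : hom X X') (g : hom Y Y'),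
    star (tensm f g) = tensm (star f) (star g);
  assoc_unitary : forall X Y Z : C, star (assoc X Y Z) = assocV X Y Z;
  lunit_unitary : forall X : C,
    star (lunit X) \c lunit X = idm _ /\ lunit X \c star (lunit X) = idm X;
  runit_unitary : forall X : C,
    star (runit X) \c runit X = idm _ /\ runit X \c star (runit X) = idm X
}.

Record unitary_fusion_category (R : realType) := UnitaryFusionCategory {
  ufc_base :> tens_category R[i];
  ufc_fusion : is_fusion_category ufc_base;
  ufc_unitary : unitary_structure ufc_base
}.

(* The Grothendieck ring of a fusion category [C] is the free abelian group on
   the classes [[S_i]] of simple objects, the coefficient of [[S_i]] in
   [[S_k] [S_j]] being the multiplicity of [S_i] in [S_k (x) S_j].  A unital
   ring isomorphism from [A] mapping the basis onto these classes is thus a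
   labelling [S] of the simple objects, up to isomorphism, by the basis of [A]
   which is compatible with units and structure constants. *)
Definition grothendieck_iso (K : fieldType) (C : tens_category K) n
    (A : fusion_ring n) : Prop :=
  exists S : 'I_n.+1 -> C,
    [/\ simple_representatives S,
        isomorphic (S ord0) tens_unit
      & forall k j, multiplicities S (tens (S k) (S j)) (fusion_coef A k j)].

Definition unitary_categorification (R : realType) n (A : fusion_ring n) : Prop :=
  exists C : unitary_fusion_category R, grothendieck_iso C A.

(* Main.v *)
(* Write [d] for the quantum dimensions.  Expanding the quadratic form and
   rotating the indices of the vector [v], one has to show that the kernel
     G((i, c, d), (j, c', d')) = \sum_k N_{jk}^i N_{kc}^{c'} N_{kd}^{d'} / d_k
   on triples of simple objects is positive.  It is a Gram matrix: for each
   triple (a, b, r) of simple objects, the composites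
     b -> i d -> i c r -> a r
   define an operator Z_{icd} on Hom(b, a r), and G is a weighted sum over
   (a, b, r) of the numbers tr(Z_{icd} Z_{jc'd'}^* ).  To compute that sum, one
   replaces the orthogonal basis of Hom(i c, j c') made of the morphisms
   i c -> a -> j c' by the one made of the morphisms i c -> j k c -> j c'; the
   sums over b and over r then reduce to orthogonality relations for
   6j-symbols.  These relations hold because Frobenius reciprocity, from
   Hom(b, k d) to Hom(d, k^* b), is isometric up to the factor d_b / d_d.
   Finally [d] is a positive eigenvector of every fusion matrix and of its
   transpose, so that d_k = ||M_k|| by the Schur test. *)
Require Import Defs.
From HB Require Import structures.
From mathcomp Require Import all_boot all_order all_algebra.
From mathcomp Require Import complex mxtens ring.
From mathcomp Require Import boolp classical_sets reals.
Import Order.TTheory GRing.Theory Num.Theory.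
Local Open Scope ring_scope.

Set Implicit Arguments.
Unset Strict Implicit.
Unset Printing Implicit Defensive.

(** * Linear and monoidal categories *)

Local Notation hom := Defs.hom.
Local Notation compA := Defs.compA.
Local Notation "g • f" := (Defs.comp g f) (at level 40, left associativity).
Local Notation "X ◁ f" := (tensm (idm X) f) (at level 32, right associativity).
Local Notation "f ▷ X" := (tensm f (idm X)) (at level 31, left associativity).

(** The definition of a unitary fusion category supplies neither strictness nor a trace, and this
    shapes the proof. Against associators, cups and vertices are tensored on the right with an
    arbitrary object [W] and land in right-nested products. Such families are morphisms of module
    functors, so on [X ⊗ -] with [X] simple the endomorphisms among them are scalars. Traces come
    from balanced cups: the two loops of a duality are positive multiples of the identity of the
    unit object, and rescaling makes them equal. The role of sphericality is played by the isometry
    of Frobenius reciprocity, obtained from an inequality applied both to a vertex and to its bend.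
    Completeness of the bent vertices, and the change of basis in [Hom(i c, j c')], follow from
    orthogonality by counting dimensions in the fusion ring. *)

Section LinearCategory.
Variables (K : fieldType) (C : lin_category K).
Implicit Types X Y Z W : C.

Lemma compDr X Y Z (g : hom Y Z) (f h : hom X Y) : g • (f + h) = g • f + g • h.
Proof. by have := comp_linear_r g 1 f h; rewrite !scale1r. Qed.

Lemma compDl X Y Z (g h : hom Y Z) (f : hom X Y) : (g + h) • f = g • f + h • f.
Proof. by have := comp_linear_l f 1 g h; rewrite !scale1r. Qed.

Lemma comp0r X Y Z (g : hom Y Z) : g • (0 : hom X Y) = 0.
Proof. by apply: (addrI (g • 0)); rewrite -compDr !addr0. Qed.

Lemma comp0l X Y Z (f : hom X Y) : (0 : hom Y Z) • f = 0.
Proof. by apply: (addrI (0 • f)); rewrite -compDl !addr0. Qed.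

Lemma compZr X Y Z a (g : hom Y Z) (f : hom X Y) : g • (a *: f) = a *: (g • f).
Proof. by have := comp_linear_r g a f 0; rewrite comp0r !addr0. Qed.

Lemma compZl X Y Z a (g : hom Y Z) (f : hom X Y) : (a *: g) • f = a *: (g • f).
Proof. by have := comp_linear_l f a g 0; rewrite comp0l !addr0. Qed.

Lemma compNr X Y Z (g : hom Y Z) (f : hom X Y) : g • (- f) = - (g • f).
Proof. by rewrite -scaleN1r compZr scaleN1r. Qed.

Lemma compNl X Y Z (g : hom Y Z) (f : hom X Y) : (- g) • f = - (g • f).
Proof. by rewrite -scaleN1r compZl scaleN1r. Qed.

Lemma comp_sumr X Y Z (I : Type) (r : seq I) (P : pred I) (g : hom Y Z)
    (F : I -> hom X Y) :
  g • (\sum_(i <- r | P i) F i) = \sum_(i <- r | P i) (g • F i).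
Proof. by apply: (big_morph (fun f => g • f)) => [f h|]; rewrite ?compDr ?comp0r. Qed.

Lemma comp_suml X Y Z (I : Type) (r : seq I) (P : pred I) (f : hom X Y)
    (F : I -> hom Y Z) :
  (\sum_(i <- r | P i) F i) • f = \sum_(i <- r | P i) (F i • f).
Proof. by apply: (big_morph (fun g => g • f)) => [g h|]; rewrite ?compDl ?comp0l. Qed.

(* Compositions are kept left-nested; [cE e] rewrites with [e] inside one. *)
Lemma cE X Y Z W (g : hom Y Z) (f : hom X Y) h (e : g • f = h) (u : hom Z W) :
  u • g • f = u • h.
Proof. by rewrite -compA e. Qed.

End LinearCategory.

(** * Coherence, and vertices tensored on the right *)

Section Coherence.
Variables (K : fieldType) (C : tens_category K).
Implicit Types X Y Z W : C.

Lemma whlM X Y Y' Y'' (g : hom Y' Y'') (f : hom Y Y') :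
  X ◁ (g • f) = X ◁ g • X ◁ f.
Proof. by rewrite -tensm_comp comp_idl. Qed.

Lemma whrM X Y Y' Y'' (g : hom Y' Y'') (f : hom Y Y') :
  (g • f) ▷ X = g ▷ X • f ▷ X.
Proof. by rewrite -tensm_comp comp_idl. Qed.

Lemma wh_swap X X' Y Y' (f : hom X X') (g : hom Y Y') :
  X' ◁ g • f ▷ Y = f ▷ Y' • X ◁ g.
Proof. by rewrite -!tensm_comp !comp_idl !comp_idr. Qed.

Lemma whlD X Y Y' (f g : hom Y Y') : X ◁ (f + g) = X ◁ f + X ◁ g.
Proof. by have := tensm_linear_r (idm X) 1 f g; rewrite !scale1r. Qed.

Lemma whl0 X Y Y' : X ◁ (0 : hom Y Y') = 0.
Proof. by apply: (addrI (X ◁ 0)); rewrite -whlD !addr0. Qed.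

Lemma whlZ X Y Y' a (f : hom Y Y') : X ◁ (a *: f) = a *: (X ◁ f).
Proof. by have := tensm_linear_r (idm X) a f 0; rewrite whl0 !addr0. Qed.

Lemma whrD X Y Y' (f g : hom Y Y') : (f + g) ▷ X = f ▷ X + g ▷ X.
Proof. by have := tensm_linear_l (idm X) 1 f g; rewrite !scale1r. Qed.

Lemma whr0 X Y Y' : (0 : hom Y Y') ▷ X = 0.
Proof. by apply: (addrI (0 ▷ X)); rewrite -whrD !addr0. Qed.

Lemma whrZ X Y Y' a (f : hom Y Y') : (a *: f) ▷ X = a *: (f ▷ X).
Proof. by have := tensm_linear_l (idm X) a f 0; rewrite whr0 !addr0. Qed.

Lemma whl_sum X Y Y' (I : Type) (r : seq I) (P : pred I) (F : I -> hom Y Y') :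
  X ◁ (\sum_(i <- r | P i) F i) = \sum_(i <- r | P i) X ◁ F i.
Proof. by apply: (big_morph (tensm (idm X))) => [g h|]; rewrite ?whlD ?whl0. Qed.

Lemma assoc_whll X Y Z Z' (h : hom Z Z') :
  assoc X Y Z' • (tens X Y) ◁ h = X ◁ (Y ◁ h) • assoc X Y Z.
Proof. by rewrite -tensm_id assoc_natural. Qed.

Lemma assoc_whlr X Y Y' Z (g : hom Y Y') :
  assoc X Y' Z • (X ◁ g) ▷ Z = X ◁ (g ▷ Z) • assoc X Y Z.
Proof. exact: assoc_natural. Qed.

Lemma assoc_whrr X X' Y Z (f : hom X X') :
  assoc X' Y Z • (f ▷ Y) ▷ Z = f ▷ (tens Y Z) • assoc X Y Z.
Proof. by rewrite assoc_natural tensm_id. Qed.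

Lemma assoc_epi X Y Z V (f g : hom (tens X (tens Y Z)) V) :
  f • assoc X Y Z = g • assoc X Y Z -> f = g.
Proof.
by move=> /(congr1 (fun h => h • assocV X Y Z)); rewrite -!compA assocVK !comp_idr.
Qed.

Lemma assoc_mono X Y Z V (f g : hom V (tens (tens X Y) Z)) :
  assoc X Y Z • f = assoc X Y Z • g -> f = g.
Proof.
by move=> /(congr1 (fun h => assocV X Y Z • h)); rewrite !compA assocK !comp_idl.
Qed.

Lemma assocV_whll X Y Z Z' (h : hom Z Z') :
  assocV X Y Z' • X ◁ (Y ◁ h) = (tens X Y) ◁ h • assocV X Y Z.
Proof.
apply: assoc_mono.
by rewrite !compA assoc_whll assocVK comp_idl -compA assocVK comp_idr.
Qed.

Lemma assocV_whlr X Y Y' Z (g : hom Y Y') :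
  assocV X Y' Z • X ◁ (g ▷ Z) = (X ◁ g) ▷ Z • assocV X Y Z.
Proof.
apply: assoc_mono.
by rewrite !compA assoc_whlr assocVK comp_idl -compA assocVK comp_idr.
Qed.

Lemma assocV_whrr X X' Y Z (f : hom X X') :
  assocV X' Y Z • f ▷ (tens Y Z) = (f ▷ Y) ▷ Z • assocV X Y Z.
Proof.
apply: assoc_mono.
by rewrite !compA assoc_whrr assocVK comp_idl -compA assocVK comp_idr.
Qed.

Lemma whl_unit_inj X Y (f g : hom X Y) :
  (tens_unit : C) ◁ f = tens_unit ◁ g -> f = g.
Proof.
have [l [_ ll]] := lunit_iso X; move=> fg.
by rewrite -[f]comp_idr -[g]comp_idr -ll !compA -!lunit_natural fg.
Qed.

(** Kelly's consequence of the pentagon and the triangle: tensoring with the unit on the left is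
    faithful, and precomposing with invertible associators then brings both axioms into play. *)
Lemma lunit_tens X Y : lunit (tens X Y) • assoc tens_unit X Y = lunit X ▷ Y.
Proof.
apply: whl_unit_inj; rewrite whlM.
apply: assoc_epi.
have epi (f g : hom (tens (tens tens_unit (tens tens_unit X)) Y)
                    (tens tens_unit (tens X Y))) :
  f • assoc tens_unit tens_unit X ▷ Y = g • assoc tens_unit tens_unit X ▷ Y -> f = g.
  move=> /(congr1 (fun h => h • assocV tens_unit tens_unit X ▷ Y)).
  by rewrite -!compA -whrM assocVK tensm_id !comp_idr.
apply: epi.
rewrite -!compA (compA (_ ◁ assoc _ _ _)) -pentagon compA triangle.
rewrite -assoc_whrr -triangle whrM !compA.
by rewrite assoc_whlr.
Qed.

(** [vert] is locked so that rewriting treats it as one arrow and does not reach the associator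
    inside. *)
Fact vert_key : unit. Proof. exact: tt. Qed.

Definition vert X Y Z (s : hom Z (tens X Y)) W : hom (tens Z W) (tens X (tens Y W)) :=
  locked_with vert_key (assoc X Y W • s ▷ W).

Lemma vertE X Y Z (s : hom Z (tens X Y)) W : vert s W = assoc X Y W • s ▷ W.
Proof. by rewrite /vert unlock. Qed.

Lemma vert_nat X Y Z (s : hom Z (tens X Y)) W W' (f : hom W W') :
  X ◁ (Y ◁ f) • vert s W = vert s W' • Z ◁ f.
Proof. by rewrite !vertE compA -assoc_whll -compA wh_swap !compA. Qed.

Lemma vert_tens X Y Z (s : hom Z (tens X Y)) V W :
  X ◁ assoc Y V W • assoc X (tens Y V) W • (vert s V) ▷ W
  = vert s (tens V W) • assoc Z V W.
Proof.
by rewrite !vertE whrM !compA -pentagon -[RHS]compA -assoc_whrr !compA.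
Qed.

End Coherence.

(** The C*-axioms in algebraic form. Definiteness is [dag_eq0]; in [dag_pos], [g] is an
    endomorphism, hence a scalar when the source is simple. *)
Record dagger_structure (K : numClosedFieldType) (C : tens_category K) := Dagger {
  dag : forall X Y : C, hom X Y -> hom Y X;
  dag_antilinear : forall (X Y : C) (a : K) (f g : hom X Y),
    dag (a *: f + g) = a^* *: dag f + dag g;
  dagK : forall (X Y : C) (f : hom X Y), dag (dag f) = f;
  dagM : forall (X Y Z : C) (g : hom Y Z) (f : hom X Y),
    dag (g • f) = dag f • dag g;
  dag_eq0 : forall (X Y : C) (f : hom X Y), dag f • f = 0 -> f = 0;
  dag_pos : forall (X Y : C) (f : hom X Y),
    exists g : hom X X, dag f • f = dag g • g;
  dag_tens : forall (X X' Y Y' : C) (f : hom X X') (g : hom Y Y'),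
    dag (tensm f g) = tensm (dag f) (dag g);
  dag_assoc : forall X Y Z : C, dag (assoc X Y Z) = assocV X Y Z;
  dag_lunitK : forall X : C, dag (lunit X) • lunit X = idm _;
  lunit_dagK : forall X : C, lunit X • dag (lunit X) = idm X;
  dag_runitK : forall X : C, dag (runit X) • runit X = idm _;
  runit_dagK : forall X : C, runit X • dag (runit X) = idm X
}.
Arguments dag {K C} d [X Y] f.

(** * Daggers and cups *)

Section Dagger.
Variables (K : numClosedFieldType) (C : tens_category K) (D : dagger_structure C).
Implicit Types X Y Z W V : C.
Local Notation "f ^†" := (dag D f) (at level 2, left associativity, format "f ^†").

Lemma dagD X Y (f g : hom X Y) : (f + g)^† = f^† + g^†.
Proof. by have := dag_antilinear D 1 f g; rewrite rmorph1 !scale1r. Qed.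

Lemma dag0 X Y : (0 : hom X Y)^† = 0.
Proof. by apply: (addrI (0 : hom X Y)^†); rewrite -dagD !addr0. Qed.

Lemma dagZ X Y a (f : hom X Y) : (a *: f)^† = a^* *: f^†.
Proof. by have := dag_antilinear D a f 0; rewrite dag0 !addr0. Qed.

Lemma dag_sum X Y (I : Type) (r : seq I) (P : pred I) (F : I -> hom X Y) :
  (\sum_(i <- r | P i) F i)^† = \sum_(i <- r | P i) (F i)^†.
Proof. by apply: (big_morph (@dag _ _ D X Y)) => [g h|]; rewrite ?dagD ?dag0. Qed.

Lemma dag_id X : (idm X)^† = idm X.
Proof. by rewrite -[RHS](dagK D) -[in RHS](comp_idl (idm X)^†) dagM dagK comp_idl. Qed.

Lemma dag_whl X Y Y' (f : hom Y Y') : (X ◁ f)^† = X ◁ f^†.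
Proof. by rewrite dag_tens dag_id. Qed.

Lemma dag_whr X Y Y' (f : hom Y Y') : (f ▷ X)^† = f^† ▷ X.
Proof. by rewrite dag_tens dag_id. Qed.

Lemma lunitV_nat X X' (f : hom X X') :
  (lunit X')^† • f = tens_unit ◁ f • (lunit X)^†.
Proof.
have := lunit_natural f^†; move/(congr1 (@dag _ _ D _ _)).
by rewrite !dagM dag_whl dagK.
Qed.

Lemma lunitV_tens X Y :
  assoc tens_unit X Y • (lunit X)^† ▷ Y = (lunit (tens X Y))^†.
Proof.
by rewrite -dag_whr -lunit_tens dagM dag_assoc compA assocVK comp_idl.
Qed.

Lemma vert_dag X Y Z (s : hom Z (tens X Y)) W :
  (vert s W)^† = s^† ▷ W • assocV X Y W.
Proof. by rewrite vertE dagM dag_assoc dag_whr. Qed.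

Lemma vert_dagM X Y Z Z' (s : hom Z (tens X Y)) (t : hom Z' (tens X Y)) W :
  (vert t W)^† • vert s W = (t^† • s) ▷ W.
Proof. by rewrite vert_dag vertE compA (cE (assocK _ _ _)) comp_idr whrM. Qed.

Lemma vert_dag_nat X Y Z (s : hom Z (tens X Y)) W W' (f : hom W W') :
  Z ◁ f • (vert s W)^† = (vert s W')^† • X ◁ (Y ◁ f).
Proof.
have := vert_nat s f^†; move/(congr1 (@dag _ _ D _ _)).
by rewrite !dagM !dag_whl dagK.
Qed.

Fact cup_key : unit. Proof. exact: tt. Qed.

Definition cup X' X (r : hom tens_unit (tens X' X)) W : hom W (tens X' (tens X W)) :=
  locked_with cup_key (assoc X' X W • r ▷ W • (lunit W)^†).

Lemma cupE X' X (r : hom tens_unit (tens X' X)) W :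
  cup r W = assoc X' X W • r ▷ W • (lunit W)^†.
Proof. by rewrite /cup unlock. Qed.

Lemma cup_nat X' X (r : hom tens_unit (tens X' X)) W W' (f : hom W W') :
  X' ◁ (X ◁ f) • cup r W = cup r W' • f.
Proof.
rewrite !cupE -[RHS]compA lunitV_nat !compA -assoc_whll.
by rewrite -(compA (assoc _ _ _)) wh_swap !compA.
Qed.

Lemma cup_dag_nat X' X (r : hom tens_unit (tens X' X)) W W' (f : hom W W') :
  f • (cup r W)^† = (cup r W')^† • X' ◁ (X ◁ f).
Proof.
have := cup_nat r f^†; move/(congr1 (@dag _ _ D _ _)).
by rewrite !dagM !dag_whl dagK => ->.
Qed.

Lemma cup_tens X' X (r : hom tens_unit (tens X' X)) V W :
  X' ◁ assoc X V W • assoc X' (tens X V) W • (cup r V) ▷ W = cup r (tens V W).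
Proof.
rewrite !cupE !whrM !compA -pentagon.
by rewrite (cE (assoc_whrr _ _ _)) !compA (cE (lunitV_tens _ _)).
Qed.

Lemma cup_norm X' X (r : hom tens_unit (tens X' X)) a W :
  r^† • r = a *: idm tens_unit -> (cup r W)^† • cup r W = a *: idm W.
Proof.
move=> ra; rewrite !cupE !dagM dagK dag_whr dag_assoc !compA.
rewrite (cE (assocK _ _ _)) comp_idr -(compA _ (_ ▷ _) (_ ▷ _)) -whrM ra whrZ tensm_id.
by rewrite compZr comp_idr compZl lunit_dagK.
Qed.

(** The triangle axiom removes the unit constraints from the conjugate equation once it is tensored
    with [W]. *)
Lemma zigzag X X' (r : hom tens_unit (tens X' X)) (s : hom tens_unit (tens X X')) :
  lunit X • s^† ▷ X • assocV X X' X • X ◁ r = runit X ->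
  forall W, (cup s (tens X W))^† • X ◁ (cup r W) = idm (tens X W).
Proof.
move=> zz W; rewrite -cup_tens !dagM dag_whl !dag_assoc dag_whr !cupE.
rewrite !whlM !compA -(compA _ (X ◁ assocV _ _ _)) -whlM assocK tensm_id comp_idr.
rewrite (cE (assocV_whlr _ _ _)) !compA.
rewrite -whrM !dagM dagK dag_assoc dag_whr !compA zz -triangle.
by rewrite (cE (assocVK _ _ _)) comp_idr -whlM lunit_dagK tensm_id.
Qed.

(* Balanced solutions of the conjugate equations: both loops have value [a]. *)
Record dual_pair X X' (r : hom tens_unit (tens X' X)) (s : hom tens_unit (tens X X'))
    (a : K) : Prop := DualPair {
  dual_zz1 : forall W, (cup s (tens X W))^† • X ◁ (cup r W) = idm (tens X W);
  dual_zz2 : forall W, (cup r (tens X' W))^† • X' ◁ (cup s W) = idm (tens X' W);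
  dual_norm1 : r^† • r = a *: idm tens_unit;
  dual_norm2 : s^† • s = a *: idm tens_unit;
  dual_gt0 : 0 < a
}.

Lemma dual_pairC X X' r s a : @dual_pair X X' r s a -> @dual_pair X' X s r a.
Proof. by case. Qed.

End Dagger.

(** * Module natural transformations *)

Section ModularFamilies.
Variables (K : numClosedFieldType) (C : tens_category K) (D : dagger_structure C).
Implicit Types X Y Z W V : C.
Local Notation "f ^†" := (dag D f) (at level 2, left associativity, format "f ^†").

(** Simplicity in the form used for computations; [simple_schur] derives it from the absence of
    proper subobjects. *)
Definition schur X := idm X <> 0 /\ forall f : hom X X, exists a, f = a *: idm X.

Lemma schur_iso X Y (f : hom X Y) : is_iso f -> schur X -> schur Y.
Proof.
case=> g [gf fg] [X0 Xs]; split=> [Y0|h].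
  by apply: X0; rewrite -gf -[f]comp_idl Y0 comp0l comp0r.
have [a ha] := Xs (g • h • f); exists a.
have -> : h = f • (g • h • f) • g by rewrite !compA fg comp_idl -compA fg comp_idr.
by rewrite ha compZr comp_idr compZl fg.
Qed.

Lemma schur_inj X a b : schur X -> a *: idm X = b *: idm X -> a = b.
Proof.
move=> [X0 _] /eqP; rewrite -subr_eq0 -scalerBl scaler_eq0 subr_eq0.
by case/orP=> /eqP.
Qed.

Lemma schur_ge0 X Y (f : hom X Y) a : schur X -> f^† • f = a *: idm X -> 0 <= a.
Proof.
move=> hX fa; have [g gf] := dag_pos D f; have [c hc] := hX.2 g.
rewrite fa hc dagZ dag_id compZl compZr comp_idl scalerA in gf.
by rewrite (schur_inj hX gf) mulrC mul_conjC_ge0.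
Qed.

Lemma schur_unit X : schur X -> schur (tens X tens_unit).
Proof.
have [g [gl lg]] := runit_iso X; apply: (@schur_iso _ _ g).
by exists (runit X).
Qed.

(** The functor [W |-> X_1 (X_2 (... W))] attached to a word of objects. *)
Fixpoint act (ws : seq C) W : C := if ws is X :: us then tens X (act us W) else W.

Fixpoint act_lunit (ws : seq C) W : hom (tens (act ws tens_unit) W) (act ws W) :=
  if ws is X :: us then X ◁ act_lunit us W • assoc X (act us tens_unit) W
  else lunit W.

Lemma act_lunit_dagK ws W : act_lunit ws W • (act_lunit ws W)^† = idm _.
Proof.
elim: ws => [|X us IH] /=; first exact: lunit_dagK.
rewrite dagM dag_assoc !compA (cE (assocVK _ _ _)) comp_idr dag_whl.
by rewrite -whlM IH tensm_id.
Qed.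

Lemma dag_act_lunitK ws W : (act_lunit ws W)^† • act_lunit ws W = idm _.
Proof.
elim: ws => [|X us IH] /=; first exact: dag_lunitK.
rewrite dagM dag_assoc dag_whl !compA -(compA _ (X ◁ _) (X ◁ _)) -whlM IH.
by rewrite tensm_id comp_idr assocK.
Qed.

(* These are the natural transformations commuting with right tensoring; they
   are determined by their component at the unit object. *)
Definition modular ws us (eta : forall W, hom (act ws W) (act us W)) :=
  forall W, eta W • act_lunit ws W = act_lunit us W • eta tens_unit ▷ W.

Lemma modular_comp ws us vs eta theta :
  @modular ws us eta -> @modular us vs theta ->
  @modular ws vs (fun W => theta W • eta W).
Proof. by move=> he ht W; rewrite -compA he compA ht -compA whrM. Qed.

Lemma modular_dag ws us eta :
  @modular ws us eta -> @modular us ws (fun W => (eta W)^†).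
Proof.
move=> he W; rewrite -[LHS]comp_idl -(act_lunit_dagK ws W) -!compA; congr (_ • _).
by rewrite compA -dagM he dagM -compA dag_act_lunitK comp_idr dag_whr.
Qed.

Lemma modular_whl X ws us eta :
  @modular ws us eta -> @modular (X :: ws) (X :: us) (fun W => X ◁ eta W).
Proof.
by move=> he W /=; rewrite compA -whlM he whlM -!compA assoc_whlr.
Qed.

Lemma modular_cup X' X (r : hom tens_unit (tens X' X)) vs :
  @modular vs [:: X', X & vs] (fun W => cup D r (act vs W)).
Proof.
move=> W /=; rewrite -cup_nat -cup_tens !whlM !compA.
by rewrite -!(compA (X' ◁ (X ◁ _))).
Qed.

Lemma modular_vert X Y Z (s : hom Z (tens X Y)) vs :
  @modular (Z :: vs) [:: X, Y & vs] (fun W => vert s (act vs W)).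
Proof.
move=> W /=; rewrite compA -vert_nat -compA -vert_tens !whlM !compA.
by [].
Qed.

(** The component at the unit is an endomorphism of [X ⊗ 1], isomorphic to [X], hence a scalar, and
    [modular] carries this scalar to every [W]. *)
Lemma modular_scalar X eta :
  schur X -> @modular [:: X] [:: X] eta -> exists a, forall W, eta W = a *: idm _.
Proof.
move=> hX he; have [a ha] := (schur_unit hX).2 (eta tens_unit).
exists a => W; rewrite -[LHS]comp_idr -(act_lunit_dagK [:: X] W) compA he ha.
by rewrite whrZ tensm_id compZr comp_idr compZl (act_lunit_dagK [:: X] W).
Qed.

End ModularFamilies.

(** * Frobenius reciprocity *)

Section Frobenius.
Variables (K : numClosedFieldType) (C : tens_category K) (D : dagger_structure C).
Hypothesis unit_schur : schur (tens_unit : C).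
Implicit Types X Y Z W V : C.
Local Notation "f ^†" := (dag D f) (at level 2, left associativity, format "f ^†").

(** The dual is [schur] too, so that [irrC] can exchange an object with its dual, at equal
    dimension. *)
Record irr := Irr {
  irr_obj :> C;
  irr_dual : C;
  irr_rcup : hom tens_unit (tens irr_dual irr_obj);
  irr_lcup : hom tens_unit (tens irr_obj irr_dual);
  qdim : K;
  irr_pair : dual_pair D irr_rcup irr_lcup qdim;
  irr_schur : schur irr_obj;
  irr_dual_schur : schur irr_dual
}.

Definition irrC (x : irr) : irr :=
  Irr (dual_pairC (irr_pair x)) (irr_dual_schur x) (irr_schur x).

Local Notation "x ^∨" := (irr_dual x) (at level 2, left associativity, format "x ^∨").
Local Notation rc x W := (cup D (irr_rcup x) W).
Local Notation lc x W := (cup D (irr_lcup x) W).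

Section Pair.
Variable x : irr.
Lemma rl_zigzag W : (lc x (tens x W))^† • (x : C) ◁ rc x W = idm _.
Proof. exact: dual_zz1 (irr_pair x) W. Qed.
Lemma lr_zigzag W : (x : C) ◁ (rc x W)^† • lc x (tens x W) = idm _.
Proof. by have /(congr1 (@dag _ _ D _ _)) := rl_zigzag W; rewrite dagM dagK dag_whl dag_id. Qed.
Lemma rc_norm W : (rc x W)^† • rc x W = qdim x *: idm W.
Proof. exact: cup_norm (dual_norm1 (irr_pair x)). Qed.
Lemma lc_norm W : (lc x W)^† • lc x W = qdim x *: idm W.
Proof. exact: cup_norm (dual_norm2 (irr_pair x)). Qed.
Lemma qdim_gt0 : 0 < qdim x.
Proof. exact: dual_gt0 (irr_pair x). Qed.
End Pair.

(** Frobenius reciprocity from [Hom(b, k d)] to [Hom(d, k^∨ b)], antilinear because of the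
    dagger. *)
Definition bend (k : irr) d b (s : hom b (tens k d)) : hom d (tens k^∨ b) :=
  k^∨ ◁ s^† • rc k d.

Lemma bend_vert (k : irr) d b (s : hom b (tens k d)) W :
  vert (bend s) W = k^∨ ◁ (vert s W)^† • rc k (tens d W).
Proof.
rewrite -cup_tens vertE /bend whrM !compA assoc_whlr vert_dag whlM ?compA.
rewrite -(compA _ (_ ◁ assocV _ _ _) (_ ◁ assoc _ _ _)) -whlM assocK tensm_id.
by rewrite comp_idr.
Qed.

Lemma bendK (k : irr) d b (s : hom b (tens k d)) :
  (k : C) ◁ (bend s)^† • lc k b = s.
Proof.
rewrite /bend dagM dag_whl dagK whlM -compA cup_nat compA.
by rewrite lr_zigzag comp_idl.
Qed.

(** All four factors commute with tensoring on the right, so [modular_scalar] applies to their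
    composite. *)
Lemma loop_right (k : irr) d d' (c : hom tens_unit (tens d d')) b (s : hom b (tens k d)) :
  exists a, forall W,
    (k : C) ◁ (cup D c W)^† • vert s (tens d' W) • (vert s (tens d' W))^†
      • (k : C) ◁ cup D c W = a *: idm (tens k W).
Proof.
have mc := modular_whl k (modular_cup D c [::]).
have ms := modular_vert s [:: d'].
have [a ha] := modular_scalar D (irr_schur k)
  (modular_comp (modular_comp mc (modular_dag D ms))
     (modular_comp ms (modular_dag D mc))).
by exists a => W; rewrite -ha /= dag_whl !compA.
Qed.

(* Closing [k] on the left and closing [d] on the right commute, so that both
   ways of closing [s s^†] give the same number (Longo and Roberts). *)
Lemma loop_eq (k d : irr) b (s : hom b (tens k d)) p q :
  (bend s)^† • bend s = p *: idm (d : C) ->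
  (forall W, (k : C) ◁ (lc d W)^† • vert s (tens d^∨ W) • (vert s (tens d^∨ W))^†
      • (k : C) ◁ lc d W = q *: idm (tens k W)) ->
  p * qdim d = q * qdim k.
Proof.
move=> hp hq; apply: (schur_inj unit_schur); pose W := tens_unit : C.
have <- : (rc k W)^† • k^∨ ◁ (q *: idm (tens k W)) • rc k W
          = q * qdim k *: idm W.
  by rewrite whlZ tensm_id compZr comp_idr compZl rc_norm scalerA.
rewrite -hq !whlM !compA -[LHS]/(_ *: idm W).
rewrite (cE (cup_nat _ _ _)) !compA.
have -> : (rc k W)^† • k^∨ ◁ ((k : C) ◁ (lc d W)^†)
          = (lc d W)^† • (rc k (tens d (tens d^∨ W)))^†.
  by rewrite -cup_dag_nat.
rewrite -!(compA _ (k^∨ ◁ _) (rc k _)) -bend_vert.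
have -> : (lc d W)^† • (rc k (tens d (tens d^∨ W)))^† • k^∨ ◁ vert s (tens d^∨ W)
         = (lc d W)^† • (vert (bend s) (tens d^∨ W))^†.
  by rewrite bend_vert dagM dag_whl dagK compA.
rewrite (cE (vert_dagM _ _ _ _)) hp whrZ tensm_id compZr comp_idr compZl lc_norm.
by rewrite scalerA.
Qed.

(* The Cauchy-Schwarz inequality applied to [x] and [sg sg^† x], where [x]
   and [y] are [s] bent all the way round to the left and to the right, and
   [sg : b^∨ -> d^∨ k^∨] is a transpose of [s^†] obtained from [y]. *)
Lemma bend_norm_ge (k d b : irr) (s : hom (b : C) (tens k d)) n p :
  s^† • s = n *: idm (b : C) -> (bend s)^† • bend s = p *: idm (d : C) ->
  n * qdim b <= p * qdim d.
Proof.
move=> hn hp.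
have n0 : 0 <= n := schur_ge0 (irr_schur b) hn.
have p0 : 0 <= p := schur_ge0 (irr_schur d) hp.
have := n0; rewrite le_eqVlt => /orP[/eqP<-|n_gt0].
  by rewrite mul0r mulr_ge0 // ltW // qdim_gt0.
have p_gt0 : 0 < p.
  rewrite lt_neqAle p0 andbT; apply/eqP=> pe0.
  have b0 : bend s = 0 by apply: (dag_eq0 (d:=D)); rewrite hp -pe0 scale0r.
  have s0 : s = 0 by rewrite -(bendK s) b0 dag0 whl0 comp0l.
  move: hn; rewrite s0 comp0r -[LHS](scale0r (idm (b : C))).
  by move/(schur_inj (irr_schur b)) => n00; rewrite -n00 ltxx in n_gt0.
have [q hq] := loop_right (irr_lcup d) s.
have pq := loop_eq hp hq.
pose y W := (vert s (tens d^∨ (tens k^∨ W)))^† • (k : C) ◁ lc d (tens k^∨ W) • lc k W.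
pose x W := d^∨ ◁ vert (bend s) W • rc d W.
pose sg W := (rc b (tens d^∨ (tens k^∨ W)))^† • b^∨ ◁ y W.
have yy W : (y W)^† • y W = q * qdim k *: idm W.
  transitivity ((lc k W)^† • (q *: idm _) • lc k W).
    by rewrite -hq /y !dagM dagK dag_whl !compA.
  by rewrite compZr comp_idr compZl lc_norm scalerA.
have xx W : (x W)^† • x W = p * qdim d *: idm W.
  rewrite /x dagM dag_whl compA -(compA _ (d^∨ ◁ _) (d^∨ ◁ _)) -whlM vert_dagM hp.
  by rewrite whrZ tensm_id whlZ tensm_id compZr comp_idr compZl rc_norm scalerA.
have my : modular (ws := [::]) (us := [:: (b : C); d^∨; k^∨]) y.
  exact: (modular_comp (modular_cup D (irr_lcup k) [::])
    (modular_comp (modular_whl k (modular_cup D (irr_lcup d) [:: k^∨]))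
      (modular_dag D (modular_vert s [:: d^∨; k^∨])))).
have msg : modular (ws := [:: b^∨]) (us := [:: d^∨; k^∨]) sg.
  exact: (modular_comp (modular_whl b^∨ my)
    (modular_dag D (modular_cup D (irr_rcup b) [:: d^∨; k^∨]))).
have [t ht] := modular_scalar D (irr_dual_schur b) (modular_comp msg (modular_dag D msg)).
have ysg W : y W = (b : C) ◁ sg W • lc b W.
  rewrite /sg whlM -compA cup_nat compA lr_zigzag comp_idl.
  by [].
(* [y^† y] evaluated twice: by closing the legs [d] and [k], and through [sg]. *)
have qt : q * qdim k = t * qdim b.
  apply: (schur_inj unit_schur); rewrite -yy ysg dagM dag_whl compA.
  rewrite -(compA _ (_ ◁ _) (_ ◁ _)) -whlM ht whlZ tensm_id compZr comp_idr compZl.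
  by rewrite lc_norm scalerA.
(* The zigzags for [d] and [k] straighten these legs, leaving [s^† s]. *)
have yx W : (y (tens b W))^† • (b : C) ◁ x W = n *: idm (tens b W).
  have zd : (lc d (tens k^∨ (tens b W)))^† • (d : C) ◁ x W = vert (bend s) W.
    by rewrite /x whlM compA -cup_dag_nat -compA rl_zigzag comp_idr.
  have zk : (lc k (tens b W))^† • (k : C) ◁ vert (bend s) W = (vert s W)^†.
    by rewrite bend_vert whlM compA -cup_dag_nat -compA rl_zigzag comp_idr.
  rewrite /y !dagM dagK dag_whl !compA (cE (esym (vert_nat _ _))) compA.
  rewrite -(compA _ (_ ◁ (lc d _)^†)) -whlM zd zk.
  by rewrite vert_dagM hn whrZ tensm_id.
have sgx W : (sg (tens b W))^† • x W = n *: rc b W.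
  rewrite /sg dagM dagK dag_whl -compA -cup_nat compA -whlM yx.
  by rewrite whlZ tensm_id compZl comp_idl.
clearbody sg x y.
pose W := tens_unit : C.
(* Since [sg^† sg = t], [sg sg^† / t] is a projection, and [f] is [t] times the part of [x]
   orthogonal to its range. *)
pose f := t *: x W - sg (tens b W) • (sg (tens b W))^† • x W.
have t_gt0 : 0 < t.
  rewrite -(pmulr_lgt0 _ (qdim_gt0 b)) -qt -pq mulr_gt0 // qdim_gt0 //.
have nc : n^* = n by rewrite (CrealP (ger0_real n0)).
have tc : t^* = t by rewrite (CrealP (ger0_real (ltW t_gt0))).
have ff : f^† • f = (t * (t * (p * qdim d) - n * (n * qdim b))) *: idm W.
  have v2 : (sg (tens b W) • (sg (tens b W))^† • x W)^†
     • (sg (tens b W) • (sg (tens b W))^† • x W) = (t * (n * (n * qdim b))) *: idm W.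
    rewrite !dagM dagK !compA -(compA _ (sg _)^† (sg _)) ht compZr comp_idr !compZl.
    rewrite -(compA _ (sg _)^† (x W)) sgx -(dagK D (sg (tens b W))) -dagM sgx.
    by rewrite dagZ nc compZl compZr rc_norm !scalerA !mulrA.
  have vx : (sg (tens b W) • (sg (tens b W))^† • x W)^† • x W = (n * (n * qdim b)) *: idm W.
    rewrite !dagM dagK -!compA sgx compA -(dagK D (sg (tens b W))) -dagM sgx.
    by rewrite dagZ nc compZl compZr rc_norm !scalerA !mulrA.
  have xv : (x W)^† • (sg (tens b W) • (sg (tens b W))^† • x W) = (n * (n * qdim b)) *: idm W.
    by rewrite -[RHS]vx !dagM dagK !compA.
  rewrite /f dagD dagZ tc -scaleN1r dagZ rmorphN1 compDl !compDr.
  rewrite !(compZl, compZr) xx v2 vx xv !scalerA -!scalerDl.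
  by congr (_ *: _); ring.
have := schur_ge0 unit_schur ff; rewrite pmulr_rge0 // subr_ge0 => le1.
have qb := qdim_gt0 b.
(* After multiplication by [qdim b] the right side is a square, as
   [t * qdim b = q * qdim k = p * qdim d]. *)
have : (n * qdim b) ^+ 2 <= (p * qdim d) ^+ 2.
  have -> : (p * qdim d) ^+ 2 = t * (p * qdim d) * qdim b.
    by rewrite expr2 {1}pq qt; ring.
  have -> : (n * qdim b) ^+ 2 = n * (n * qdim b) * qdim b by ring.
  by rewrite ler_pM2r.
by rewrite ler_sqr // nnegrE mulr_ge0 // ltW // qdim_gt0.
Qed.

(* The opposite inequality is [bend_norm_ge] for the bent vertex. *)
Lemma bend_norm (k d b : irr) (s : hom (b : C) (tens k d)) n :
  s^† • s = n *: idm (b : C) ->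
  (bend s)^† • bend s = (n * qdim b / qdim d) *: idm (d : C).
Proof.
move=> hn; have [p hp] := (irr_schur d).2 ((bend s)^† • bend s).
have le1 := bend_norm_ge hn hp.
have le2 := @bend_norm_ge (irrC k) b d (bend s) p n hp.
rewrite hp; congr (_ *: _); apply: (mulIf (lt0r_neq0 (qdim_gt0 d))).
rewrite mulfVK ?(lt0r_neq0 (qdim_gt0 d)) //; apply/le_anti/andP; split=> //.
by apply: le2; rewrite /bend /= -/(bend s) bendK.
Qed.

End Frobenius.

(** * Parseval identities and scalars *)

Lemma square_inverse (K : fieldType) (P Q : finType) (A : Q -> P -> K) (B : P -> Q -> K) :
  #|P| = #|Q| ->
  (forall q q', \sum_p A q p * B p q' = (q == q')%:R) ->
  forall p p', \sum_q B p q * A q p' = (p == p')%:R.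
Proof.
move=> eqPQ AB p p'.
pose e (i : 'I_#|P|) : Q := enum_val (cast_ord eqPQ i).
have eK i : enum_rank (e i) = cast_ord eqPQ i by rewrite enum_valK.
have eI : injective e.
  by move=> i j /(congr1 enum_rank); rewrite !eK => /(congr1 val) /= /val_inj.
pose MA := \matrix_(i < #|P|, j < #|P|) A (e i) (enum_val j).
pose MB := \matrix_(i < #|P|, j < #|P|) B (enum_val i) (e j).
have MAB : MA *m MB = 1%:M.
  apply/matrixP=> i j; rewrite !mxE -(inj_eq eI) -AB.
  rewrite [RHS](reindex (enum_val (A := P))) /=; last first.
    exact: onW_bij (enum_val_bij _).
  by apply: eq_bigr => k _; rewrite !mxE.
have /matrixP /(_ (enum_rank p) (enum_rank p')) := mulmx1C MAB.
rewrite !mxE (inj_eq enum_rank_inj) => <-.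
rewrite (reindex e) /=; last first.
  apply: onW_bij; exists (fun q => cast_ord (esym eqPQ) (enum_rank q)) => i.
    by rewrite eK cast_ordK.
  by rewrite /e cast_ordKV enum_rankK.
by apply: eq_bigr => k _; rewrite !mxE !enum_rankK.
Qed.

(** The hypothesis makes [wP * F / wQ] and the conjugate of [F] inverse on one side. Being square,
    they are inverse on the other side too: the rows of [F] are orthogonal for the weights [1 / wQ],
    with squared norms [1 / wP]. *)
Lemma weighted_parseval (K : numClosedFieldType) (P Q : finType)
    (F : P -> Q -> K) (wP : P -> K) (wQ : Q -> K) (l : P -> K) :
  #|P| = #|Q| -> (forall p, wP p != 0) -> (forall q, wQ q != 0) ->
  (forall q q', \sum_p wP p * (F p q * (F p q')^* ) = (q == q')%:R * wQ q) ->
  \sum_q (wQ q)^-1 * `|\sum_p l p * F p q| ^+ 2 = \sum_p (wP p)^-1 * `|l p| ^+ 2.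
Proof.
move=> cPQ wP0 wQ0 orth.
have orth' q q' : \sum_p wP p * (F p q / wQ q) * (F p q')^* = (q == q')%:R.
  under eq_bigr => r _.
    have -> : wP r * (F r q / wQ q) * (F r q')^* = (wQ q)^-1 * (wP r * (F r q * (F r q')^* )).
      by ring.
    over.
  rewrite -mulr_sumr orth; case: eqP => [->|_]; last by rewrite mul0r mulr0.
  by rewrite mul1r mulVf.
have inv p p' : \sum_q (F p' q)^* * (F p q / wQ q) = (p' == p)%:R / wP p.
  have <- := square_inverse (A := fun q p => wP p * (F p q / wQ q)) cPQ orth' p' p.
  rewrite mulr_suml; apply: eq_bigr => q _.
  have := wP0 p; move: (wP p) (wQ q) (F p q) (F p' q)^* => a b c d a0.
  by rewrite (mulrC a) !mulrA mulfK.
transitivity (\sum_p \sum_p' l p * (l p')^* * \sum_q (F p' q)^* * (F p q / wQ q)).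
  under eq_bigr => q _.
    rewrite normCK rmorph_sum big_distrlr mulr_sumr /=.
    under eq_bigr do rewrite mulr_sumr.
    over.
  rewrite exchange_big /=; apply: eq_bigr => p _.
  rewrite exchange_big /=; apply: eq_bigr => p' _.
  rewrite mulr_sumr; apply: eq_bigr => q _.
  by rewrite rmorphM /=; ring.
apply: eq_bigr => p _.
under eq_bigr do rewrite inv.
rewrite (bigD1 p) //= eqxx big1 ?addr0; last first.
  by move=> p' /negPf ->; rewrite mul0r mulr0.
by rewrite normCK div1r mulrC.
Qed.

(** * Scalars of endomorphisms of simple objects *)

Section Scalars.
Variables (K : numClosedFieldType) (C : tens_category K) (D : dagger_structure C).
Implicit Types X Y Z W V : C.
Local Notation "f ^†" := (dag D f) (at level 2, left associativity, format "f ^†").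

(* The scalar of an endomorphism of a simple object (a junk value when [f] is
   not a multiple of the identity). *)
Definition scal X (f : hom X X) : K := xget 0 [set a | f = a *: idm X]%classic.

Variables (X : C) (hX : schur X).

Lemma scalE (f : hom X X) : f = scal f *: idm X.
Proof. by have [a fa] := hX.2 f; rewrite /scal; case: xgetP => [b _ //|/(_ a)]; case. Qed.

Lemma scal_id a : scal (a *: idm X) = a.
Proof. by apply: (schur_inj hX); rewrite -scalE. Qed.

Lemma scalD (f g : hom X X) : scal (f + g) = scal f + scal g.
Proof. by rewrite [in LHS](scalE f) [in LHS](scalE g) -scalerDl scal_id. Qed.

Lemma scalZ a (f : hom X X) : scal (a *: f) = a * scal f.
Proof. by rewrite [in LHS](scalE f) scalerA scal_id. Qed.

Lemma scal0 : scal (0 : hom X X) = 0.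
Proof. by rewrite -(scale0r (idm X)) scal_id. Qed.

Lemma scal_sum (I : Type) (r : seq I) (P : pred I) (F : I -> hom X X) :
  scal (\sum_(i <- r | P i) F i) = \sum_(i <- r | P i) scal (F i).
Proof. by apply: (big_morph (@scal X)) => [g h|]; rewrite ?scalD ?scal0. Qed.

Lemma scal_dag (f : hom X X) : scal (f^†) = (scal f)^*.
Proof. by rewrite [in LHS](scalE f) dagZ dag_id scal_id. Qed.

Lemma scalM (f g : hom X X) : scal (f • g) = scal f * scal g.
Proof. by rewrite [in LHS](scalE f) compZl comp_idl scalZ. Qed.

End Scalars.

(** Polarization by [s + t] and [s + 'i *: t]. It extends [bend_norm], which concerns one vertex, to
    inner products of two. *)
Lemma sesquilinear_diag_eq0 (K : numClosedFieldType) (V : lmodType K) (q : V -> V -> K) :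
  (forall s t u, q s (t + u) = q s t + q s u) ->
  (forall s t u, q (s + t) u = q s u + q t u) ->
  (forall a s t, q s (a *: t) = a * q s t) ->
  (forall a s t, q (a *: s) t = a^* * q s t) ->
  (forall s, q s s = 0) -> forall s t, q s t = 0.
Proof.
move=> qDr qDl qZr qZl q0 s t.
have h1 := q0 (s + t); rewrite qDr !qDl !q0 add0r addr0 in h1.
have h2 := q0 (s + 'i *: t); rewrite qDr !qDl !q0 qZr qZl conjCi in h2.
rewrite add0r addr0 mulNr addrC -mulrBr in h2.
move/eqP: h2; rewrite mulf_eq0 (negPf (neq0Ci _)) /= => /eqP h2.
have : 2 * q s t = 0 by rewrite -[RHS](addr0 0) -{1}h1 -h2; ring.
by move/eqP; rewrite mulf_eq0 pnatr_eq0 /= => /eqP.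
Qed.

(** * The Gram identity *)

Lemma sum_pairs_perm (K : nmodType) (A B E A' B' E' : finType)
    (h : A -> B -> E -> A' -> B' -> E' -> K) :
  \sum_(p : A * B * E) \sum_(p' : A' * B' * E') h p.1.1 p.1.2 p.2 p'.1.1 p'.1.2 p'.2
  = \sum_(u : A * A') \sum_(y : B * B') \sum_(z : E * E') h u.1 y.1 z.1 u.2 y.2 z.2.
Proof.
rewrite pair_bigA; under [RHS]eq_bigr do rewrite pair_bigA.
rewrite pair_bigA /=.
pose f (w : A * A' * (B * B' * (E * E'))) : A * B * E * (A' * B' * E') :=
  ((w.1.1, w.2.1.1, w.2.2.1), (w.1.2, w.2.1.2, w.2.2.2)).
rewrite (reindex f) //=; apply: onW_bij.
exists (fun w => ((w.1.1.1, w.2.1.1), ((w.1.1.2, w.2.1.2), (w.1.2, w.2.2)))).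
  by case=> [[a a'] [[b b'] [e e']]].
by case=> [[[a b] e] [[a' b'] e']].
Qed.

Lemma sum_sig (K : nmodType) (I : finType) (J : I -> finType) (G : forall i, J i -> K) :
  \sum_i \sum_(j : J i) G i j = \sum_(p : {i : I & J i}) G (tag p) (tagged p).
Proof. exact: (sig_big_dep (op := +%R) xpredT (fun _ => xpredT)). Qed.

Lemma card_sig (I : finType) (J : I -> finType) : #|{: {i : I & J i}}| = (\sum_i #|J i|)%N.
Proof. by rewrite card_tagged sumnE big_map big_enum. Qed.

(** The left side is the Hilbert-Schmidt product of two sums of rank one operators, given by the
    vectors [t p] and [t' p]. *)
Lemma gram_square (K : numClosedFieldType) (T T' L : finType) (t : T -> L -> K)
    (t' : T' -> L -> K) :
  \sum_f \sum_f' (\sum_p t p f * (t p f')^* ) * (\sum_p t' p f * (t' p f')^* )^*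
  = \sum_p \sum_p' `|\sum_f t p f * (t' p' f)^* | ^+ 2.
Proof.
transitivity (\sum_f \sum_f' \sum_p \sum_p'
    (t p f * (t' p' f)^* ) * (t p f' * (t' p' f')^* )^* ).
  apply: eq_bigr => f _; apply: eq_bigr => f' _.
  rewrite rmorph_sum big_distrlr; apply: eq_bigr => p _; apply: eq_bigr => p' _ /=.
  by rewrite !rmorphM /= !conjCK; ring.
under eq_bigr do rewrite exchange_big.
rewrite exchange_big; apply: eq_bigr => p _.
under eq_bigr do rewrite exchange_big.
rewrite exchange_big; apply: eq_bigr => p' _.
by rewrite normCK rmorph_sum big_distrlr.
Qed.

(** * Orthonormal vertices, 6j-symbols and the positive kernel *)

Section Frames.
Variables (K : numClosedFieldType) (C : tens_category K) (D : dagger_structure C).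
Local Notation "f ^†" := (dag D f) (at level 2, left associativity, format "f ^†").
Hypothesis unit_schur : schur (tens_unit : C).
Variables (I : finType) (S : I -> C) (dual : I -> I).
Hypothesis S_schur : forall i, schur (S i).
Hypothesis S_neq : forall i j, i != j -> forall f : hom (S i) (S j), f = 0.
Variables (rcup : forall i, hom tens_unit (tens (S (dual i)) (S i)))
  (lcup : forall i, hom tens_unit (tens (S i) (S (dual i)))) (qd : I -> K).
Hypothesis S_pair : forall i, dual_pair D (rcup i) (lcup i) (qd i).
Variables (N : I -> I -> I -> nat)
  (V : forall k j i, 'I_(N k j i) -> hom (S i) (tens (S k) (S j))).
Hypothesis V_orth : forall k j i (u v : 'I_(N k j i)),
  (V u)^† • V v = (u == v)%:R *: idm (S i).
Hypothesis V_complete : forall k j,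
  \sum_i \sum_(u < N k j i) V u • (V u)^† = idm (tens (S k) (S j)).
Hypothesis N_dual : forall k j i, N k j i = N (dual k) i j.
Hypothesis N_assoc : forall i j d d',
  (\sum_b N i d b * N j d' b = \sum_k N j k i * N k d d')%N.

Definition simple_irr i : irr D := Irr (S_pair i) (S_schur i) (S_schur (dual i)).

Local Notation x := simple_irr.
Local Notation rc k W := (cup D (rcup k) W).
Local Notation lc k W := (cup D (lcup k) W).
Local Notation "[[ f ]]" := (scal f) (at level 0, f at level 99).

Let qd_gt0 i : 0 < qd i. Proof. exact: (qdim_gt0 (x i)). Qed.
Let qd_neq0 i : qd i != 0. Proof. exact: lt0r_neq0. Qed.
Let sE i := scalE (S_schur i).

Lemma bend_orth (k d b : I) (s t : hom (S b) (tens (S k) (S d))) :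
  (bend (k := x k) t)^† • bend (k := x k) s
  = ([[s^† • t]] * qd b / qd d) *: idm (S d).
Proof.
pose q (s t : hom (S b) (tens (S k) (S d))) : K :=
  [[(bend (k := x k) t)^† • bend (k := x k) s]] - [[s^† • t]] * qd b / qd d.
have sD := scalD (S_schur _); have sZ := scalZ (S_schur _).
have q0 : q s t = 0.
  apply: sesquilinear_diag_eq0 => [{}s {}t u|{}s {}t u|a {}s {}t|a {}s {}t|{}s].
  - rewrite /q /bend !dagM !dag_whl !dagK whlD compDr !compDl compDr !sD; ring.
  - rewrite /q /bend !dagD whlD !compDl !compDr !sD; ring.
  - rewrite /q /bend !dagM !dag_whl !dagK whlZ !compZr !compZl !sZ; ring.
  - rewrite /q /bend !dagZ whlZ !compZl compZr !sZ; ring.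
  have := @bend_norm _ _ D unit_schur (x k) (x d) (x b) s _ (sE (s^† • s)).
  by rewrite /q => ->; rewrite (scal_id (S_schur d)) subrr.
rewrite [LHS]sE; congr (_ *: _).
by apply/eqP; rewrite -subr_eq0; apply/eqP.
Qed.

Lemma bend_V_orth k d b (u v : 'I_(N k d b)) :
  (bend (k := x k) (V v))^† • bend (k := x k) (V u)
  = ((u == v)%:R * qd b / qd d) *: idm (S d).
Proof. by rewrite bend_orth V_orth (scal_id (S_schur b)). Qed.

Lemma absorb i d b (f : hom (tens (S i) (S d)) (S b)) :
  \sum_(u < N i d b) f • V u • (V u)^† = f.
Proof.
rewrite -[RHS]comp_idr -V_complete comp_sumr [RHS](bigD1 b) //= [X in _ + X]big1 ?addr0 => [|c cb].
  by rewrite comp_sumr; apply: eq_bigr => u _; rewrite compA.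
rewrite comp_sumr big1 // => u _.
by rewrite compA (S_neq cb (f • V u)) comp0l.
Qed.

Lemma absorb_dag i d b (f : hom (S b) (tens (S i) (S d))) :
  \sum_(u < N i d b) V u • ((V u)^† • f) = f.
Proof.
rewrite -[RHS](dagK D) -(absorb f^†) dag_sum; apply: eq_bigr => u _.
by rewrite !dagM !dagK.
Qed.

Lemma scal_norm_sum i d b (f : hom (S b) (tens (S i) (S d))) :
  \sum_(u < N i d b) `|[[(V u)^† • f]]| ^+ 2 = [[f^† • f]].
Proof.
rewrite -[X in _ = scal (_ • X)](absorb_dag f) comp_sumr (scal_sum (S_schur b)).
apply: eq_bigr => u _.
rewrite normCK compA (scalM (S_schur b)) mulrC; congr (_ * _).
by rewrite -(scal_dag D (S_schur b)) dagM dagK.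
Qed.

(** The quantum trace of [T], computed over the channels [b] and by closing [j]. When [T] is
    expanded in the matrix units [V u • (V v)^†], bending gives each diagonal one the factor
    [qd b / qd d] and kills the others. *)
Lemma trace_bend j d (T : hom (tens (S j) (S d)) (tens (S j) (S d))) :
  \sum_b qd b * (\sum_(u < N j d b) [[(V u)^† • T • V u]])
  = qd d * [[(rc j (S d))^† • S (dual j) ◁ T • rc j (S d)]].
Proof.
have eT : T = \sum_b \sum_(u < N j d b) \sum_(v < N j d b)
    [[(V u)^† • T • V v]] *: (V u • (V v)^†).
  rewrite -[LHS]comp_idl -V_complete comp_suml; apply: eq_bigr => b _.
  rewrite comp_suml; apply: eq_bigr => u _.
  rewrite -compA -[in LHS](absorb ((V u)^† • T)) comp_sumr; apply: eq_bigr => v _.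
  by rewrite [in LHS](sE ((V u)^† • T • V v)) compZl comp_idl compZr.
rewrite [X in _ ◁ X]eT whl_sum comp_sumr comp_suml (scal_sum (S_schur d)) mulr_sumr.
apply: eq_bigr => b _; rewrite whl_sum comp_sumr comp_suml (scal_sum (S_schur d)).
rewrite !mulr_sumr; apply: eq_bigr => u _.
rewrite whl_sum comp_sumr comp_suml (scal_sum (S_schur d)) mulr_sumr.
rewrite (bigD1 u) //= big1 ?addr0 => [|v vu].
  rewrite whlZ whlM compZr compZl compA -(compA _ _ (rc j _)).
  have -> : (rc j (S d))^† • S (dual j) ◁ V u • (S (dual j) ◁ (V u)^† • rc j (S d))
         = (bend (k := x j) (V u))^† • bend (k := x j) (V u).
    by rewrite [in RHS]/bend dagM dag_whl dagK.
  rewrite bend_V_orth eqxx mul1r (scalZ (S_schur d)) (scal_id (S_schur d)).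
  by field; exact: qd_neq0.
rewrite whlZ whlM compZr compZl compA -(compA _ _ (rc j _)).
have -> : (rc j (S d))^† • S (dual j) ◁ V u • (S (dual j) ◁ (V v)^† • rc j (S d))
         = (bend (k := x j) (V u))^† • bend (k := x j) (V v).
  by rewrite [in RHS]/bend dagM dag_whl dagK.
by rewrite bend_V_orth (negPf vu) !mul0r scale0r scaler0 (scal0 (S_schur d)) mulr0.
Qed.

Lemma cross_trace i d j d' (X X' : hom (tens (S i) (S d)) (tens (S j) (S d'))) :
  \sum_b qd b * (\sum_(g < N i d b) \sum_(g' < N j d' b)
     [[(V g')^† • X • V g]] * [[(V g')^† • X' • V g]]^* )
  = qd d' * [[(rc j (S d'))^† • S (dual j) ◁ (X • X'^†) • rc j (S d')]].
Proof.
rewrite -trace_bend; apply: eq_bigr => b _; congr (_ * _).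
rewrite exchange_big; apply: eq_bigr => g' _ /=.
rewrite compA -[in RHS](absorb ((V g')^† • X)) !comp_suml (scal_sum (S_schur b)).
apply: eq_bigr => g _.
rewrite -!(compA (_ • V g)) (scalM (S_schur b)); congr (_ * _).
by rewrite -(scal_dag D (S_schur b)) !dagM !dagK !compA.
Qed.

(** Closing [j] bends [w] and [w'] and brings them together: between [v'] and [v^†] there remains an
    arrow [S k' -> S k], to which Schur's lemma applies. *)
Lemma loop_vert i d d' j k k' (w : hom (S i) (tens (S j) (S k)))
    (w' : hom (S i) (tens (S j) (S k'))) (v : hom (S d') (tens (S k) (S d)))
    (v' : hom (S d') (tens (S k') (S d))) :
  (rc j (S d'))^† • S (dual j) ◁ ((S j ◁ v^† • vert w (S d)) • (S j ◁ v'^† • vert w' (S d))^†)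
    • rc j (S d')
  = v^† • ((bend (k := x j) w)^† • bend (k := x j) w') ▷ S d • v'.
Proof.
rewrite -(vert_dagM D) !bend_vert !dagM !dag_whl !dagK !whlM !compA.
by rewrite (cE (cup_nat D _ _)) !compA -cup_dag_nat.
Qed.

(* The 6j-symbols comparing the channels [i d -> b -> j d'] and
   [i d -> j k d -> j d']. *)
Definition cross i d j d' k (w : 'I_(N j k i)) (v : 'I_(N k d d')) b
    (g : 'I_(N i d b)) (g' : 'I_(N j d' b)) : K :=
  [[(V g')^† • (S j ◁ (V v)^† • vert (V w) (S d)) • V g]].

Lemma cross_orth i d j d' k (w w' : 'I_(N j k i)) (v v' : 'I_(N k d d')) :
  \sum_b qd b * (\sum_(g < N i d b) \sum_(g' < N j d' b)
     cross w v g g' * (cross w' v' g g')^* )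
  = ((w == w') && (v == v'))%:R * (qd i * qd d' / qd k).
Proof.
rewrite cross_trace loop_vert bend_V_orth whrZ tensm_id compZr comp_idr compZl.
rewrite V_orth scalerA (scal_id (S_schur d')) eq_sym.
by case: (w == w'); case: (v == v'); rewrite ?(mul0r, mulr0, mul1r) //= mulr1;
  field; exact: qd_neq0.
Qed.

Lemma cross_orth_neq i d j d' k k' (w : 'I_(N j k i)) (v : 'I_(N k d d'))
    (w' : 'I_(N j k' i)) (v' : 'I_(N k' d d')) :
  k != k' ->
  \sum_b qd b * (\sum_(g < N i d b) \sum_(g' < N j d' b)
     cross w v g g' * (cross w' v' g g')^* ) = 0.
Proof.
move=> kk'; rewrite eq_sym in kk'; rewrite cross_trace loop_vert.
rewrite (S_neq kk' ((bend (k := x j) (V w))^† • bend (k := x j) (V w'))).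
by rewrite whr0 comp0r comp0l (scal0 (S_schur d')) mulr0.
Qed.

(** The bent vertices are orthogonal, of squared norm [qd d / qd r], and [N_dual] makes them as many
    as the orthonormal basis of the same space. The matrix [U] between the two is thus square, and
    the weight [qd r] compensates the norms. *)
Lemma bend_complete c d :
  \sum_r qd r *: \sum_(g < N c r d) bend (k := x c) (V g) • (bend (k := x c) (V g))^†
  = qd d *: idm (tens (S (dual c)) (S d)).
Proof.
rewrite -V_complete scaler_sumr; apply: eq_bigr => r _.
pose U (h : 'I_(N (dual c) d r)) (g : 'I_(N c r d)) := [[(V h)^† • bend (k := x c) (V g)]].
have bE g : bend (k := x c) (V g) = \sum_h U h g *: V h.
  rewrite -[LHS]absorb_dag; apply: eq_bigr => h _.
  by rewrite [in LHS](sE ((V h)^† • bend (k := x c) (V g))) compZr comp_idr.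
have UU g g' : \sum_h (U h g')^* * U h g = (g == g')%:R * qd d / qd r.
  have := bend_V_orth g g'; rewrite bE dag_sum comp_suml.
  under eq_bigr => h _.
    rewrite dagZ compZl. over.
  move=> /(congr1 (@scal _ _ _)); rewrite (scal_id (S_schur r)) => <-.
  rewrite (scal_sum (S_schur r)); apply: eq_bigr => h _.
  by rewrite (scalZ (S_schur r)).
have UV h h' : \sum_g U h g * (U h' g)^* = (h == h')%:R * qd d / qd r.
  have inv := @square_inverse K 'I_(N (dual c) d r) 'I_(N c r d)
    (fun g h => (U h g)^* * (qd r / qd d)) U.
  rewrite mulrAC -mulrA -inv.
  - rewrite mulr_suml; apply: eq_bigr => g _; field.
    by rewrite !qd_neq0.
  - by rewrite !card_ord (N_dual c r d).
  move=> g g'; under eq_bigr => i _ do rewrite mulrAC.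
  rewrite -mulr_suml UU eq_sym; field.
  by rewrite !qd_neq0.
rewrite !scaler_sumr.
under eq_bigr => g _.
  rewrite bE dag_sum comp_suml scaler_sumr.
  under eq_bigr => h _.
    rewrite comp_sumr scaler_sumr.
    under eq_bigr => h' _ do rewrite dagZ compZl compZr !scalerA.
    over.
  over.
rewrite exchange_big; apply: eq_bigr => h _ /=.
rewrite exchange_big (bigD1 h) //= [X in _ + X]big1 ?addr0 => [|h' hh'].
  rewrite -scaler_suml; congr (_ *: _).
  by rewrite -mulr_sumr UV eqxx mul1r; field; exact: qd_neq0.
by rewrite -scaler_suml -mulr_sumr UV eq_sym (negPf hh') !mul0r mulr0 scale0r.
Qed.

(** Unbending each [V g] through a cup on [c] turns the sum, by [bend_complete], into a resolution
    of the identity of [S (dual c) ⊗ S d]. What is left is [V m] with its right leg [c] closed, a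
    loop that [loop_eq] evaluates from the left. *)
Lemma loop_complete c d k c' (m : 'I_(N k c c')) :
  \sum_r qd r *: \sum_(g < N c r d)
    S k ◁ (V g)^† • vert (V m) (S r) • (vert (V m) (S r))^† • S k ◁ V g
  = (qd d * qd c' / qd k) *: idm (tens (S k) (S d)).
Proof.
have [q hq] := loop_right (k := x k) (lcup c) (V m).
have qE : q = qd c' / qd k.
  have := loop_eq unit_schur (k := x k) (d := x c) (bend_V_orth m m) hq.
  rewrite eqxx mul1r /= divfK // => ->.
  by rewrite mulfK.
transitivity (qd d *: (S k ◁ (lc c (S d))^† • vert (V m) (tens (S (dual c)) (S d))
    • (vert (V m) (tens (S (dual c)) (S d)))^† • S k ◁ lc c (S d))); last first.
  by rewrite hq qE scalerA mulrA.
pose Y := tens (S (dual c)) (S d).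
have -> : qd d *: (S k ◁ (lc c (S d))^† • vert (V m) Y • (vert (V m) Y)^† • S k ◁ lc c (S d))
  = S k ◁ (lc c (S d))^† • (vert (V m) Y • S c' ◁ (qd d *: idm Y)) • (vert (V m) Y)^†
    • S k ◁ lc c (S d).
  by rewrite whlZ tensm_id !(compZr, compZl) comp_idr.
rewrite -bend_complete whl_sum !comp_sumr !comp_suml.
apply: eq_bigr => r _.
rewrite whlZ whl_sum !compZr !compZl !comp_sumr !comp_suml; congr (_ *: _).
apply: eq_bigr => g _.
have gE : V g = S c ◁ (bend (k := x c) (V g))^† • lc c (S d).
  by rewrite (bendK (k := x c)).
move: (bend (k := x c) (V g)) gE => h gE.
rewrite [in LHS]gE dagM dag_whl dagK !whlM !compA.
by rewrite (cE (vert_nat _ _)) !compA (cE (esym (vert_dag_nat D _ _))) !compA.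
Qed.

(* The same symbols with the sum to be taken over the position [r]. *)
Definition hook c d k c' d' (m : 'I_(N k c c')) (v : 'I_(N k d d')) r
    (g : 'I_(N c r d)) (g' : 'I_(N c' r d')) : K :=
  [[(V g')^† • ((vert (V m) (S r))^† • S k ◁ V g • V v)]].

Lemma hook_sum c d k c' d' (m : 'I_(N k c c')) :
  \sum_(v < N k d d') \sum_r qd r *
     (\sum_(g < N c r d) \sum_(g' < N c' r d') `|hook m v g g'| ^+ 2)
  = (N k d d')%:R * (qd d * qd c' / qd k).
Proof.
transitivity (\sum_(v < N k d d') (qd d * qd c' / qd k)); last first.
  by rewrite sumr_const card_ord mulr_natl.
apply: eq_bigr => v _.
rewrite -(scal_id (S_schur d') (qd d * qd c' / qd k)).
have vv := V_orth v v; rewrite eqxx scale1r in vv; rewrite -vv.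
have -> : (qd d * qd c' / qd k) *: ((V v)^† • V v)
  = (V v)^† • ((qd d * qd c' / qd k) *: idm _) • V v.
  by rewrite compZr compZl comp_idr.
rewrite -(loop_complete _ m) comp_sumr comp_suml (scal_sum (S_schur d')).
apply: eq_bigr => r _; rewrite compZr compZl (scalZ (S_schur d')); congr (_ * _).
rewrite comp_sumr comp_suml (scal_sum (S_schur d')); apply: eq_bigr => g _.
by rewrite scal_norm_sum !dagM !dagK dag_whl !compA.
Qed.

(* Coordinates of [b -> i d -> i c r -> a r]; the operator Z_{icd} is the sum of
   the rank one operators given by these vectors. *)
Definition tie i c d a b r (be : 'I_(N i c a)) (ga : 'I_(N i d b)) (g : 'I_(N c r d))
    (f : 'I_(N a r b)) : K :=
  [[(V f)^† • (vert (V be) (S r))^† • S i ◁ V g • V ga]].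

(** [e] is inserted into the closed path [b -> i d -> i c r -> j c' r -> j d' -> b]. As a functional
    of [e], this can be read in either basis of [Hom(i c, j c')]. *)
Definition ell i c d j c' d' b r (u : 'I_(N c r d) * 'I_(N c' r d'))
    (y : 'I_(N i d b) * 'I_(N j d' b)) (e : hom (tens (S i) (S c)) (tens (S j) (S c'))) : K :=
  [[(V y.2)^† • S j ◁ (V u.2)^†
    • (assoc (S j) (S c') (S r) • e ▷ S r • assocV (S i) (S c) (S r))
    • S i ◁ V u.1 • V y.1]].

Lemma ellD i c d j c' d' b r u y e e' :
  @ell i c d j c' d' b r u y (e + e') = ell u y e + ell u y e'.
Proof. by rewrite /ell whrD !(compDl, compDr) (scalD (S_schur b)). Qed.

Lemma ellZ i c d j c' d' b r u y a e :
  @ell i c d j c' d' b r u y (a *: e) = a * ell u y e.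
Proof. by rewrite /ell whrZ !(compZl, compZr) (scalZ (S_schur b)). Qed.

Lemma ell_sum i c d j c' d' b r u y (T : Type) (s : seq T) (P : pred T) F :
  @ell i c d j c' d' b r u y (\sum_(t <- s | P t) F t) = \sum_(t <- s | P t) ell u y (F t).
Proof.
apply: (big_morph (ell u y)) => [e e'|]; first exact: ellD.
by rewrite -(scale0r 0) ellZ mul0r.
Qed.

(** The sum over [f] glues two half paths at [a r], since by [absorb] the [V f] resolve every arrow
    [a r -> b]. *)
Lemma tie_ell i c d j c' d' a b r (be : 'I_(N i c a)) (ga : 'I_(N i d b))
    (g : 'I_(N c r d)) (be' : 'I_(N j c' a)) (ga' : 'I_(N j d' b)) (g' : 'I_(N c' r d')) :
  \sum_f tie be ga g f * (tie be' ga' g' f)^*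
  = ell (g, g') (ga, ga') (V be' • (V be)^†).
Proof.
pose A := (V ga')^† • S j ◁ (V g')^† • vert (V be') (S r).
pose B := (vert (V be) (S r))^† • S i ◁ V g • V ga.
transitivity [[A • B]].
  rewrite -[A]absorb comp_suml (scal_sum (S_schur b)); apply: eq_bigr => f _.
  rewrite mulrC -(scal_dag D (S_schur b)) -(scalM (S_schur b)); congr scal.
  by rewrite !dagM !dagK dag_whl /A /B !compA.
by rewrite /ell /A /B /= whrM vertE vert_dag !compA.
Qed.

Definition kvec i c j c' k (w : 'I_(N j k i)) (m : 'I_(N k c c')) :=
  S j ◁ (V m)^† • vert (V w) (S c).

(** Naturality gathers everything that involves [r] into one arrow [th : k d -> d']. Expanding it
    over [v] separates the dependence on [r] ([hook]) from that on [b] ([cross]), so that the two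
    sums can be done in turn. *)
Lemma ell_kvec i c d j c' d' b r u y k (w : 'I_(N j k i)) (m : 'I_(N k c c')) :
  @ell i c d j c' d' b r u y (kvec w m)
  = \sum_(v < N k d d') hook m v u.1 u.2 * cross w v y.1 y.2.
Proof.
pose th := (V u.2)^† • (vert (V m) (S r))^† • S k ◁ V u.1.
transitivity [[(V y.2)^† • (S j ◁ th • vert (V w) (S d)) • V y.1]].
  rewrite /ell /kvec; congr scal.
  have -> : assoc (S j) (S c') (S r) • (S j ◁ (V m)^† • vert (V w) (S c)) ▷ S r
      • assocV (S i) (S c) (S r)
    = S j ◁ (vert (V m) (S r))^† • vert (V w) (tens (S c) (S r)).
    rewrite whrM compA assoc_whlr vert_dag whlM -[RHS]comp_idr -(assocVK (S i)).
    rewrite [RHS]compA -[X in _ = X • _]compA -vert_tens !compA.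
    by rewrite -(compA _ (_ ◁ assocV _ _ _)) -whlM assocK tensm_id comp_idr.
  by rewrite /th !whlM -!compA; congr (_ • (_ • (_ • _))); rewrite !compA vert_nat.
rewrite -[th]absorb whl_sum comp_suml comp_sumr comp_suml (scal_sum (S_schur b)).
apply: eq_bigr => v _.
rewrite [X in X • (V v)^†](sE (th • V v)) compZl comp_idl whlZ compZl compZr compZl.
by rewrite (scalZ (S_schur b)) /hook /th /cross !compA.
Qed.

(* The morphisms [V z.2 • (V z.1)^†], through [S a], and [kvec w m], through
   [S j ⊗ S k ⊗ S c], form two orthogonal bases of the same space. *)
Lemma ell_parseval i c d j c' d' b r u y :
  \sum_a (qd a)^-1 * (\sum_(z : 'I_(N i c a) * 'I_(N j c' a))
     `|@ell i c d j c' d' b r u y (V z.2 • (V z.1)^†)| ^+ 2)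
  = \sum_k \sum_(w < N j k i) \sum_(m < N k c c')
      qd k / (qd i * qd c') * `|ell u y (kvec w m)| ^+ 2.
Proof.
pose P := {a : I & 'I_(N i c a) * 'I_(N j c' a)}%type.
pose Q := {k : I & 'I_(N j k i) * 'I_(N k c c')}%type.
(* With [c], [c'] in place of [d], [d'], the 6j-symbols are the change of basis, and [cross_orth]
   dictates the weights. *)
pose F (p : P) (q : Q) :=
  cross (tagged q).1 (tagged q).2 (tagged p).1 (tagged p).2.
have := @weighted_parseval K P Q F (fun p => qd (tag p)) (fun q => qd i * qd c' / qd (tag q))
  (fun p => ell u y (V (tagged p).2 • (V (tagged p).1)^†)).
have kE (q : Q) : \sum_p ell u y (V (tagged p).2 • (V (tagged p).1)^†) * F p q
    = ell u y (kvec (tagged q).1 (tagged q).2).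
  case: q => k [w m] /=; rewrite /F /=.
  rewrite -(sum_sig (fun a (z : 'I_(N i c a) * 'I_(N j c' a)) =>
    ell u y (V z.2 • (V z.1)^†) * cross w m z.1 z.2)).
  rewrite -[kvec w m]comp_idl -V_complete comp_suml ell_sum.
  apply: eq_bigr => a _.
  rewrite -(pair_bigA _ (fun z z' => ell u y (V z' • (V z)^†) * cross w m z z')) exchange_big.
  rewrite comp_suml ell_sum; apply: eq_bigr => z' _ /=.
  rewrite -compA -[in RHS](absorb ((V z')^† • _)) comp_sumr ell_sum; apply: eq_bigr => z _.
  rewrite [in RHS](sE ((V z')^† • kvec w m • V z)) compZl comp_idl compZr ellZ mulrC.
  by rewrite /cross /kvec.
move=> h; rewrite (eq_bigr _ (fun a _ => mulr_sumr _ _ _ _)).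
rewrite (sum_sig (fun a (z : 'I_(N i c a) * 'I_(N j c' a)) =>
  (qd a)^-1 * `|ell u y (V z.2 • (V z.1)^†)| ^+ 2)) -h.
- under eq_bigr do rewrite kE.
  rewrite -(sum_sig (fun k (z : 'I_(N j k i) * 'I_(N k c c')) =>
    (qd i * qd c' / qd k)^-1 * `|ell u y (kvec z.1 z.2)| ^+ 2)).
  apply: eq_bigr => k _; rewrite invf_div.
  by rewrite -(pair_bigA _ (fun w m => qd k / (qd i * qd c') * `|ell u y (kvec w m)| ^+ 2)).
(* Both families count the dimension of [Hom(i c, j c')]. *)
- rewrite !card_sig; under eq_bigr do rewrite card_prod !card_ord.
  by under [RHS]eq_bigr do rewrite card_prod !card_ord; rewrite N_assoc.
- by move=> p.
- by move=> q; rewrite !(mulf_neq0, invr_neq0).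
case=> k [w m]; case=> k' [w' m'] /=.
rewrite -(sum_sig (fun b (z : 'I_(N i c b) * 'I_(N j c' b)) =>
  qd b * (cross w m z.1 z.2 * (cross w' m' z.1 z.2)^* ))).
under eq_bigr => e _.
  rewrite -mulr_sumr.
  rewrite -(pair_bigA _ (fun z z' => cross w m z z' * (cross w' m' z z')^* )).
  over.
have [kk'|kk'] := eqVneq k k'; last first.
  rewrite cross_orth_neq // (_ : (_ == _) = false) ?mul0r //.
  by apply/eqP=> /(congr1 (@tag _ _)) /= /eqP; rewrite (negPf kk').
subst k'; rewrite cross_orth -tag_eqE /tag_eq /= eqxx tagged_asE.
by [].
Qed.

(** In [ell_kvec] only [cross] depends on [b] and [y], and [cross_orth] removes the terms with
    distinct [v], [v']. *)
Lemma ell_kvec_norm i c d j c' d' r (u : 'I_(N c r d) * 'I_(N c' r d')) k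
    (w : 'I_(N j k i)) (m : 'I_(N k c c')) :
  \sum_b qd b * (\sum_(y : 'I_(N i d b) * 'I_(N j d' b)) `|ell u y (kvec w m)| ^+ 2)
  = (qd i * qd d' / qd k) * \sum_(v < N k d d') `|hook m v u.1 u.2| ^+ 2.
Proof.
pose h (v : 'I_(N k d d')) := hook m v u.1 u.2.
transitivity (\sum_v \sum_v' h v * (h v')^* * (\sum_b qd b *
  (\sum_(g < N i d b) \sum_(g' < N j d' b) cross w v g g' * (cross w v' g g')^* ))).
  under [RHS]eq_bigr => v _.
    under eq_bigr => v' _ do rewrite mulr_sumr.
    rewrite exchange_big.
    over.
  rewrite exchange_big; apply: eq_bigr => b _ /=.
  under [RHS]eq_bigr => v _.
    under eq_bigr => v' _.
      rewrite pair_bigA /= mulrCA mulr_sumr mulr_sumr.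
      over.
    rewrite exchange_big.
    over.
  rewrite exchange_big mulr_sumr; apply: eq_bigr => y _ /=.
  rewrite ell_kvec normCK rmorph_sum big_distrlr mulr_sumr /=.
  apply: eq_bigr => v _; rewrite mulr_sumr; apply: eq_bigr => v' _.
  by rewrite rmorphM /= /h; ring.
rewrite mulr_sumr; apply: eq_bigr => v _.
rewrite (bigD1 v) //= [X in _ + X]big1 ?addr0 => [|v' /negPf vv'].
  by rewrite cross_orth !eqxx mul1r normCK mulrC.
by rewrite cross_orth eqxx eq_sym vv' mul0r mulr0.
Qed.

(** Each weight is dictated by one summation: [1 / qd a] by [ell_parseval], [qd b] by the
    6j-orthogonality in [ell_kvec_norm], [qd r] by [hook_sum]. *)
Lemma gram i c d j c' d' :
  \sum_r qd r * (\sum_b qd b * (\sum_a (qd a)^-1 * (\sum_(f < N a r b) \sum_(f' < N a r b)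
    (\sum_(p : 'I_(N c r d) * 'I_(N i d b) * 'I_(N i c a))
       tie p.2 p.1.2 p.1.1 f * (tie p.2 p.1.2 p.1.1 f')^* )
    * (\sum_(p : 'I_(N c' r d') * 'I_(N j d' b) * 'I_(N j c' a))
       tie p.2 p.1.2 p.1.1 f * (tie p.2 p.1.2 p.1.1 f')^* )^* )))
  = qd d * qd d' * (\sum_k (N j k i * N k c c' * N k d d')%:R / qd k).
Proof.
transitivity (\sum_r \sum_(u : 'I_(N c r d) * 'I_(N c' r d')) \sum_k \sum_(w < N j k i)
  \sum_(m < N k c c') qd r * (qd k / (qd i * qd c')) *
    (\sum_b qd b * (\sum_(y : 'I_(N i d b) * 'I_(N j d' b)) `|ell u y (kvec w m)| ^+ 2))).
  apply: eq_bigr => r _; rewrite mulr_sumr.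
  transitivity (\sum_b \sum_(u : 'I_(N c r d) * 'I_(N c' r d'))
     \sum_(y : 'I_(N i d b) * 'I_(N j d' b)) qd r * (qd b * (
       \sum_k \sum_(w < N j k i) \sum_(m < N k c c')
          qd k / (qd i * qd c') * `|ell u y (kvec w m)| ^+ 2))).
    apply: eq_bigr => b _.
    under eq_bigr => a _.
      rewrite gram_square.
      rewrite (sum_pairs_perm (fun g ga be g' ga' be' =>
         `|\sum_f tie be ga g f * (tie be' ga' g' f)^* | ^+ 2)) mulr_sumr.
      under eq_bigr => u _.
        rewrite mulr_sumr.
        under eq_bigr => y _.
          under eq_bigr => z _ do rewrite tie_ell -!surjective_pairing.
          over.
        over.
      over.
    rewrite exchange_big !mulr_sumr; apply: eq_bigr => u _ /=.
    rewrite exchange_big !mulr_sumr; apply: eq_bigr => y _ /=.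
    by rewrite ell_parseval.
  rewrite exchange_big; apply: eq_bigr => u _.
  under eq_bigr => b _.
    under eq_bigr => y _.
      rewrite !mulr_sumr.
      under eq_bigr => k _.
        rewrite !mulr_sumr.
        under eq_bigr => w _ do rewrite !mulr_sumr.
        over.
      over.
    rewrite exchange_big.
    over.
  rewrite exchange_big; apply: eq_bigr => k _ /=.
  under eq_bigr => b _ do rewrite exchange_big.
  rewrite exchange_big; apply: eq_bigr => w _ /=.
  under eq_bigr => b _ do rewrite exchange_big.
  rewrite exchange_big; apply: eq_bigr => m _ /=.
  rewrite mulr_sumr; apply: eq_bigr => b _; rewrite !mulr_sumr.
  by apply: eq_bigr => y _; rewrite !mulrA; congr (_ * _); ring.
under eq_bigr => r _.
  under eq_bigr => u _.
    under eq_bigr => k _.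
      under eq_bigr => w _.
        under eq_bigr => m _ do rewrite ell_kvec_norm.
        over.
      over.
    over.
  rewrite exchange_big.
  over.
rewrite exchange_big mulr_sumr; apply: eq_bigr => k _ /=.
(* The factor [qd k / (qd i * qd c')] of [ell_parseval] times [qd i * qd d' / qd k] from the sum
   over [b]. *)
transitivity (\sum_(w < N j k i) \sum_(m < N k c c') qd d' / qd c' *
   ((N k d d')%:R * (qd d * qd c' / qd k))); last first.
  rewrite !sumr_const !card_ord -!mulrnA -mulr_natl !natrM.
  by field; rewrite !qd_neq0.
under eq_bigr => r _ do rewrite exchange_big.
rewrite exchange_big; apply: eq_bigr => w _ /=.
under eq_bigr => r _ do rewrite exchange_big.
rewrite exchange_big; apply: eq_bigr => m _ /=.
rewrite -(hook_sum d d' m) exchange_big mulr_sumr; apply: eq_bigr => r _ /=.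
rewrite -mulr_sumr -mulr_sumr exchange_big /=.
under [in RHS]eq_bigr => v _ do rewrite pair_bigA /=.
rewrite -mulr_sumr; move: (\sum_v _) => t.
by field; rewrite !qd_neq0.
Qed.


(** [trace_bend] at the identity: a channel [b] contributes its multiplicity, the loop around [k]
    contributes [qd k]. *)
Lemma qd_mul k d : qd k * qd d = \sum_b (N k d b)%:R * qd b.
Proof.
have := trace_bend (idm (tens (S k) (S d))).
rewrite tensm_id comp_idr (rc_norm (x k)) (scal_id (S_schur d)) mulrC /= => <-.
apply: eq_bigr => b _; rewrite mulrC; congr (_ * _).
rewrite (eq_bigr (fun _ => 1)) => [|u _]; last first.
  by rewrite comp_idr V_orth eqxx (scal_id (S_schur b)).
by rewrite sumr_const card_ord.
Qed.

(** Dividing [z p] by [qd p.2] absorbs the factor [qd d * qd d'] of [gram]; the form becomes a sum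
    of squared moduli with positive weights. *)
Lemma gram_psd (z : I * I * I -> K) :
  0 <= \sum_p \sum_p' z p * (z p')^* *
    (\sum_k (N p'.1.1 k p.1.1 * N k p.1.2 p'.1.2 * N k p.2 p'.2)%:R / qd k).
Proof.
pose Z (p : I * I * I) a b r (f f' : 'I_(N a r b)) : K :=
  \sum_(q : 'I_(N p.1.2 r p.2) * 'I_(N p.1.1 p.2 b) * 'I_(N p.1.1 p.1.2 a))
    tie q.2 q.1.2 q.1.1 f * (tie q.2 q.1.2 q.1.1 f')^*.
pose y p a b r f f' := z p / qd p.2 * @Z p a b r f f'.
have qdC i : (qd i)^* = qd i by rewrite (CrealP (ger0_real (ltW (qd_gt0 i)))).
rewrite [leRHS](_ : _ = \sum_r qd r * (\sum_b qd b * (\sum_a (qd a)^-1 *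
   (\sum_(f < N a r b) \sum_(f' < N a r b) `|\sum_p y p a b r f f'| ^+ 2)))).
  apply: sumr_ge0 => r _; apply: mulr_ge0; first exact: ltW.
  apply: sumr_ge0 => b _; apply: mulr_ge0; first exact: ltW.
  apply: sumr_ge0 => a _; apply: mulr_ge0; first by rewrite invr_ge0 ltW.
  by do 2!(apply: sumr_ge0 => ? _); rewrite exprn_ge0.
under eq_bigr => p _.
  under eq_bigr => p' _.
    have -> : z p * (z p')^* * (\sum_k (N p'.1.1 k p.1.1 * N k p.1.2 p'.1.2 * N k p.2 p'.2)%:R / qd k)
       = (z p / qd p.2) * (z p' / qd p'.2)^* * (qd p.2 * qd p'.2 *
         (\sum_k (N p'.1.1 k p.1.1 * N k p.1.2 p'.1.2 * N k p.2 p'.2)%:R / qd k)).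
      by rewrite rmorphM /= fmorphV /= qdC; field; rewrite !qd_neq0.
    rewrite -gram mulr_sumr.
    over.
  rewrite exchange_big.
  over.
rewrite exchange_big; apply: eq_bigr => r _ /=.
under eq_bigr => p _.
  under eq_bigr => p' _ do rewrite mulrCA mulr_sumr.
  rewrite -mulr_sumr exchange_big.
  over.
rewrite -mulr_sumr; congr (_ * _); rewrite exchange_big; apply: eq_bigr => b _ /=.
under eq_bigr => p _.
  under eq_bigr => p' _ do rewrite mulrCA mulr_sumr.
  rewrite -mulr_sumr exchange_big.
  over.
rewrite -mulr_sumr; congr (_ * _); rewrite exchange_big; apply: eq_bigr => a _ /=.
under eq_bigr => p _.
  under eq_bigr => p' _ do rewrite mulrCA mulr_sumr.
  rewrite -mulr_sumr exchange_big.
  over.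
rewrite -mulr_sumr; congr (_ * _); rewrite exchange_big; apply: eq_bigr => f _ /=.
under eq_bigr => p _.
  under eq_bigr => p' _ do rewrite mulr_sumr.
  rewrite exchange_big.
  over.
rewrite exchange_big; apply: eq_bigr => f' _ /=.
rewrite normCK rmorph_sum big_distrlr; apply: eq_bigr => p _ /=.
by apply: eq_bigr => p' _; rewrite /y [in RHS]rmorphM /= /Z; ring.
Qed.

End Frames.

(** * Simple objects and their duals *)

Section Eigenvector.
Import VectorInternalTheory.

Lemma linear_eigenvector (F : closedFieldType) (U : vectType F) (L : U -> U) (u0 : U) :
  linear L -> u0 != 0 -> exists a u, u != 0 /\ L u = a *: u.
Proof.
move=> linL u0_neq0.
pose Lr (u : 'rV[F]_(dim U)) : 'rV[F]_(dim U) := v2r (L (r2v u)).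
have linLr : linear Lr by move=> a u v; rewrite /Lr linearP linL linearP.
pose Lb := HB.pack_for {linear 'rV[F]_(dim U) -> 'rV[F]_(dim U)} Lr
  (GRing.isLinear.Build _ _ _ _ Lr linLr).
have [a] : exists a, root (char_poly (lin1_mx Lb)) a.
  (* [u0] excludes dimension 0, where the characteristic polynomial is constant. *)
  apply/closed_rootP; rewrite size_char_poly; apply: contra_neq u0_neq0 => -[n0].
  by apply: (can_inj v2rK); apply/rowP => -[i lti]; exfalso; have := lti; rewrite n0.
rewrite -eigenvalue_root_char => /eigenvalueP[u uL u_neq0].
rewrite mul_rV_lin1 /= in uL.
exists a, (r2v u); split.
  by apply: contra_neq u_neq0 => ru0; rewrite -[u]r2vK ru0 linear0.
by apply: (can_inj v2rK); rewrite -[LHS]/(Lr u) uL linearZ /= r2vK.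
Qed.

End Eigenvector.

Section SchurLemma.
Variables (K : numClosedFieldType) (C : tens_category K).
Implicit Types X Y Z W : C.
Hypothesis C_abelian : abelian_category C.

Lemma kernel_mono X Y W (f : hom X Y) (k : hom W X) : is_kernel k f -> mono k.
Proof.
case=> fk ker Z g h e; have [|u [_ uU]] := ker Z (k • g).
  by rewrite compA fk comp0l.
by rewrite -(uU g) // -(uU h).
Qed.

Lemma simple_hom X Y (f : hom X Y) : simple_obj X -> simple_obj Y -> f = 0 \/ is_iso f.
Proof.
move=> [_ sX] [_ sY]; have [_ kers _ _ _] := C_abelian.
have [W [k kf]] := kers _ _ f; have [fk ker] := kf.
have [k0|[k' [_ kk']]] := sX _ _ (kernel_mono kf); last first.
  by left; rewrite -[f]comp_idr -kk' compA fk comp0l.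
apply: sY => Z g h e; have [|u [gh _]] := ker Z (g - h).
  by rewrite compDr compNr e subrr.
by apply/eqP; rewrite -subr_eq0 gh k0 comp0l.
Qed.

(** Left composition with [f] on [hom X X] has an eigenvector [g]. As [f - a] kills [g], it is not
    invertible, hence zero. *)
Lemma simple_schur X : simple_obj X -> schur X.
Proof.
move=> sX; split=> [|f]; first by case: sX.
have id_neq0 : idm X != 0 by apply/eqP; case: sX.
have linf : linear (fun g : hom X X => f • g) by exact: comp_linear_r.
have [a [g [g0 fg]]] := linear_eigenvector linf id_neq0.
exists a; apply/eqP; rewrite -subr_eq0; apply/eqP.
have [//|[h [hf _]]] := simple_hom (f - a *: idm X) sX sX.
case/eqP: g0; rewrite -[g]comp_idl -hf -compA compDl compNl fg compZl comp_idl.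
by rewrite subrr comp0r.
Qed.

End SchurLemma.

(** * Orthonormal bases of multiplicity spaces *)

Section OrthonormalBases.
Variables (K : numClosedFieldType) (C : tens_category K) (D : dagger_structure C).
Implicit Types X Y Z W : C.
Local Notation "f ^†" := (dag D f) (at level 2, left associativity, format "f ^†").

Lemma gram_schmidt Y X (s : seq (hom Y X)) : schur Y ->
  exists m (o : 'I_m -> hom Y X),
    (forall u v, (o u)^† • o v = (u == v)%:R *: idm Y) /\
    (forall f, f \in s -> \sum_u o u • ((o u)^† • f) = f).
Proof.
move=> hY; elim: s => [|f s [m [o [orth exp]]]].
  by exists 0%N, (fun _ => 0); split=> // -[].
pose r := f - \sum_u o u • ((o u)^† • f).
have [r0|r_neq0] := eqVneq r 0.
  exists m, o; split=> // g; rewrite inE => /orP[/eqP->|/exp//].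
  by apply/esym/eqP; rewrite -subr_eq0 -/r r0.
have or0 u : (o u)^† • r = 0.
  rewrite /r compDr compNr comp_sumr (bigD1 u) //= big1 ?addr0 => [|v vu].
    by rewrite compA orth eqxx scale1r comp_idl subrr.
  by rewrite compA orth eq_sym (negPf vu) scale0r comp0l.
have [c rc] := hY.2 (r^† • r).
have c_gt0 : 0 < c.
  rewrite lt_neqAle (schur_ge0 hY rc) andbT; apply: contra_neq r_neq0 => c0.
  by apply: (dag_eq0 (d := D)); rewrite rc -c0 scale0r.
pose q := (sqrtC c)^-1; pose w := q *: r.
have q_gt0 : 0 < q by rewrite invr_gt0 sqrtC_gt0.
have qc : q^* = q by rewrite (CrealP (ger0_real (ltW q_gt0))).
have qq : q * q * c = 1.
  by rewrite /q -invfM -expr2 sqrtCK mulVf // lt0r_neq0.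
have ww : w^† • w = idm Y.
  by rewrite /w dagZ qc compZl compZr rc !scalerA qq scale1r.
have ow u : (o u)^† • w = 0 by rewrite /w compZr or0 scaler0.
have wo u : w^† • o u = 0 by rewrite -[LHS](dagK D) dagM dagK ow dag0.
pose o' (u : 'I_m.+1) := if unlift ord0 u is Some v then o v else w.
have o'0 : o' ord0 = w by rewrite /o' unlift_none.
have o'S u : o' (lift ord0 u) = o u by rewrite /o' liftK.
exists m.+1, o'; split=> [u v|g].
  case: (unliftP ord0 u) => [u'|] ->; case: (unliftP ord0 v) => [v'|] ->; rewrite ?(o'0, o'S).
  - by rewrite orth (inj_eq lift_inj).
  - by rewrite ow eq_sym (negPf (neq_lift _ _)) scale0r.
  - by rewrite wo (negPf (neq_lift _ _)) scale0r.
  - by rewrite ww eqxx scale1r.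
rewrite big_ord_recl o'0; under eq_bigr do rewrite o'S.
rewrite inE => /orP[/eqP->|gs]; last first.
  rewrite exp // -{1}(exp _ gs) comp_sumr big1 ?comp0r ?add0r // => u _.
  by rewrite compA wo comp0l.
have -> : w^† • f = w^† • r.
  rewrite /r compDr compNr comp_sumr [X in - X]big1 ?subr0 // => u _.
  by rewrite compA wo comp0l.
have -> : w • (w^† • r) = r.
  rewrite /w dagZ qc !(compZl, compZr) rc compZr comp_idr !scalerA.
  by rewrite qq scale1r.
by rewrite /r subrK.
Qed.

Variables (I : finType) (S : I -> C).
Hypothesis S_schur : forall i, schur (S i).
Hypothesis S_neq : forall i j, i != j -> forall f : hom (S i) (S j), f = 0.

Section DirectSum.
Variables (X : C) (N : I -> nat).
Variables (inj : forall p : {t : I & 'I_(N t)}, hom (S (tag p)) X)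
  (prj : forall p : {t : I & 'I_(N t)}, hom X (S (tag p))).
Hypothesis prj_inj : forall p, prj p • inj p = idm _.
Hypothesis prj_inj0 : forall p q, p != q -> prj p • inj q = 0.
Hypothesis sum_inj_prj : \sum_p inj p • prj p = idm X.

Let inji i (u : 'I_(N i)) : hom (S i) X := inj (Tagged (fun t => 'I_(N t)) u).
Let prji i (u : 'I_(N i)) : hom X (S i) := prj (Tagged (fun t => 'I_(N t)) u).

Lemma direct_sum_expand i (f : hom (S i) X) : \sum_(u < N i) inji u • (prji u • f) = f.
Proof.
rewrite -[RHS]comp_idl -sum_inj_prj comp_suml.
transitivity (\sum_t \sum_(u < N t) inji u • prji u • f); last first.
  by rewrite (sum_sig (fun t (u : 'I_(N t)) => inji u • prji u • f)); apply: eq_bigr => -[].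
rewrite (bigD1 i) //=.
rewrite [X in _ + X]big1 ?addr0 => [|j ji].
  by apply: eq_bigr => u _; rewrite compA.
by rewrite big1 // => u _; rewrite -compA (S_neq _ (prji u • f)) ?comp0r // eq_sym.
Qed.

Lemma prji_inji i (u v : 'I_(N i)) : prji u • inji v = (u == v)%:R *: idm (S i).
Proof.
have [<-|uv] := eqVneq u v; first by rewrite scale1r; exact: (prj_inj (Tagged (fun t => 'I_(N t)) u)).
rewrite scale0r; apply: (@prj_inj0 (Tagged (fun t => 'I_(N t)) u) (Tagged (fun t => 'I_(N t)) v)).
by rewrite -tag_eqE /tag_eq /= eqxx tagged_asE.
Qed.

(** The inclusions of a direct sum need not be isometric, so they are orthonormalised. The resulting
    size [m] is [N i], because the matrices [A] and [B] are mutually inverse. *)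
Lemma simple_onb i : exists V : 'I_(N i) -> hom (S i) X,
  (forall u v, (V u)^† • V v = (u == v)%:R *: idm (S i)) /\
  (forall f : hom (S i) X, \sum_u V u • ((V u)^† • f) = f).
Proof.
have [m [o [orth exp]]] := gram_schmidt [seq inji u | u <- enum 'I_(N i)] (S_schur i).
have {}exp (f : hom (S i) X) : \sum_u o u • ((o u)^† • f) = f.
  rewrite -[in RHS](direct_sum_expand f) -[in LHS](direct_sum_expand f).
  under eq_bigr => u _ do rewrite !comp_sumr.
  rewrite exchange_big; apply: eq_bigr => v _ /=.
  rewrite -[in RHS](exp (inji v)) ?map_f ?mem_enum // comp_suml.
  by apply: eq_bigr => u _; rewrite !compA.
pose A := \matrix_(w < m, u < N i) scal ((o w)^† • inji u).
pose B := \matrix_(u < N i, w < m) scal (prji u • o w).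
have AB : A *m B = 1%:M.
  apply/matrixP=> w w'; rewrite !mxE.
  rewrite -(scal_id (S_schur i) (w == w')%:R) -orth -{1}(direct_sum_expand (o w')).
  rewrite comp_sumr (scal_sum (S_schur i)); apply: eq_bigr => u _.
  by rewrite !mxE -(scalM (S_schur i)) !compA.
have BA : B *m A = 1%:M.
  apply/matrixP=> u u'; rewrite !mxE.
  rewrite -(scal_id (S_schur i) (u == u')%:R) -prji_inji -{1}(exp (inji u')).
  rewrite comp_sumr (scal_sum (S_schur i)); apply: eq_bigr => w _.
  by rewrite !mxE -(scalM (S_schur i)) !compA.
have mN : m = N i by apply/eqP; rewrite eqn_leq (mulmx1_min AB) (mulmx1_min BA).
by move: (N i) mN => n e; subst n; exists o.
Qed.

Lemma onb_complete (V : forall i, 'I_(N i) -> hom (S i) X) :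
  (forall i (f : hom (S i) X), \sum_u V i u • ((V i u)^† • f) = f) ->
  \sum_i \sum_(u < N i) V i u • (V i u)^† = idm X.
Proof.
move=> exp; rewrite -[LHS]comp_idr -sum_inj_prj comp_sumr.
apply: eq_bigr => p _; rewrite compA; congr (_ • _).
rewrite comp_suml (bigD1 (tag p)) //= [X in _ + X]big1 ?addr0 => [|j jp].
  rewrite comp_suml -[RHS](exp _ (inj p)).
  by apply: eq_bigr => u _; rewrite compA.
rewrite comp_suml big1 // => u _.
by rewrite -compA (S_neq _ ((V j u)^† • inj p)) ?comp0r // eq_sym.
Qed.

End DirectSum.

End OrthonormalBases.

(** * Dual objects and balanced cups *)

Section Duals.
Variables (K : numClosedFieldType) (C : tens_category K) (D : dagger_structure C).
Implicit Types X Y Z W : C.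
Local Notation "f ^†" := (dag D f) (at level 2, left associativity, format "f ^†").

Lemma left_dual_iso X Y Z (f : hom Y Z) (g : hom Z Y) :
  g • f = idm Y -> f • g = idm Z -> left_dual X Y -> left_dual X Z.
Proof.
move=> gf fg [ev [coev [zz1 zz2]]].
exists (ev • g ▷ X), (X ◁ f • coev); split.
  rewrite -zz1 whlM whrM !compA; congr (_ • _).
  rewrite (cE (assoc_whlr _ _ _)) !compA -(compA _ (X ◁ (g ▷ X)) (X ◁ (f ▷ X))).
  by rewrite -whlM -whrM gf !tensm_id comp_idr.
(* The second zigzag for [Z] is checked after composition with the isomorphism [f ▷ tens_unit]. *)
pose h := lunit Z • (ev • g ▷ X) ▷ Z • assocV Z X Z • Z ◁ (X ◁ f • coev).
have hf : h • f ▷ tens_unit = f • runit Y.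
  rewrite /h -(compA _ (Z ◁ _)) wh_swap !compA (cE (assocV_whrr _ _ _)) !compA.
  rewrite -(compA _ (_ ▷ Z) (_ ▷ Z)) -whrM -(compA ev) -whrM gf tensm_id comp_idr.
  rewrite whlM !compA (cE (assocV_whll _ _ _)) !compA (cE (esym (wh_swap _ _))) !compA.
  by rewrite lunit_natural -zz2 !compA.
rewrite -[LHS]/h -[LHS]comp_idr -[idm (tens Z _)]tensm_id -fg whrM compA hf.
by rewrite -compA runit_natural compA fg comp_idl.
Qed.

Lemma coev_faithful X Y (ev : hom (tens Y X) tens_unit) (coev : hom tens_unit (tens X Y))
    Z (f : hom Y Z) :
  lunit Y • ev ▷ Y • assocV Y X Y • Y ◁ coev = runit Y -> X ◁ f • coev = 0 -> f = 0.
Proof.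
move=> zz fc; have [g [_ rg]] := runit_iso Y.
rewrite -[f]comp_idr -rg -zz !compA -lunit_natural.
rewrite -(compA _ (tens_unit ◁ f)) wh_swap compA -(compA _ (_ ◁ f)).
rewrite -assocV_whll.
by rewrite compA -(compA _ (Y ◁ _) (Y ◁ _)) -whlM fc whl0 comp0r comp0l.
Qed.

Lemma left_dual_pair X Y : schur (tens_unit : C) -> idm X <> 0 -> left_dual X Y ->
  exists (r : hom tens_unit (tens Y X)) (s : hom tens_unit (tens X Y)) (a : K),
    dual_pair D r s a.
Proof.
move=> hU X0 [ev [coev [zz1 zz2]]].
have zz1' : lunit X • coev^† ▷ X • assocV X Y X • X ◁ ev^† = runit X.
  have e : X ◁ ev • assoc X Y X • coev ▷ X = (runit X)^† • lunit X.
    by rewrite -zz1 !compA dag_runitK comp_idl.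
  move: e => /(congr1 (@dag _ _ D _ _)).
  rewrite !dagM dagK dag_assoc dag_whr dag_whl !compA => e.
  by rewrite -(compA (lunit X)) -(compA (lunit X)) e compA lunit_dagK comp_idl.
have [a ha] := hU.2 (ev • ev^†).
have [b hb] := hU.2 (coev^† • coev).
have ha' : (ev^†)^† • ev^† = a *: idm tens_unit by rewrite dagK.
have [gl [gll lgl]] := lunit_iso X; have [gr [grr rgr]] := runit_iso X.
have lX0 : lunit X <> 0.
  by move=> l0; apply: X0; rewrite -lgl l0 comp0l.
have a_gt0 : 0 < a.
  rewrite lt_neqAle (schur_ge0 hU ha') andbT; apply/eqP=> a0; apply: lX0.
  have ev0 : ev^† = 0 by apply: (dag_eq0 (d := D)); rewrite ha' -a0 scale0r.
  by rewrite -zz1 -[ev](dagK D) ev0 dag0 whl0 comp0r !comp0l.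
have b_gt0 : 0 < b.
  rewrite lt_neqAle (schur_ge0 hU hb) andbT; apply/eqP=> b0; apply: lX0.
  have c0 : coev = 0 by apply: (dag_eq0 (d := D)); rewrite hb -b0 scale0r.
  by rewrite -zz1 c0 whr0 comp0r.
(* Scaling [ev^†] by [t] and [coev] by [t^-1] keeps the zigzags and multiplies the loops [a] and [b]
   by [t^2] and [t^-2]; they agree when [t^4 = b / a]. *)
pose t := sqrtC (sqrtC (b / a)).
have t_gt0 : 0 < t by rewrite !sqrtC_gt0 divr_gt0.
have t0 : t != 0 by rewrite lt0r_neq0.
have tc : t^* = t by rewrite (CrealP (ger0_real (ltW t_gt0))).
have tt : t * t * (t * t) = b / a by rewrite -!expr2 !sqrtCK.
have a0 : a != 0 by rewrite lt0r_neq0.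
exists (t *: ev^†), (t^-1 *: coev), (t * t * a); split.
- apply: zigzag; rewrite dagZ whrZ whlZ fmorphV /= tc !(compZl, compZr) zz1'.
  by rewrite scalerA mulfV // scale1r.
- apply: zigzag; rewrite dagZ dagK whrZ whlZ tc !(compZl, compZr) zz2.
  by rewrite scalerA mulVf // scale1r.
- by rewrite dagZ tc compZl compZr ha' !scalerA.
- rewrite dagZ fmorphV /= tc compZl compZr hb !scalerA; congr (_ *: _).
  have -> : b = t * t * (t * t) * a by rewrite tt divfK.
  by field.
by rewrite !mulr_gt0.
Qed.

End Duals.

Section SimpleDuals.
Variables (K : numClosedFieldType) (C : tens_category K) (D : dagger_structure C).
Local Notation "f ^†" := (dag D f) (at level 2, left associativity, format "f ^†").
Variables (n : nat) (S : 'I_n.+1 -> C) (dual : 'I_n.+1 -> 'I_n.+1)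
  (N : 'I_n.+1 -> 'I_n.+1 -> 'I_n.+1 -> nat)
  (V : forall k j i, 'I_(N k j i) -> hom (S i) (tens (S k) (S j))).
Hypothesis S_reps : simple_representatives S.
Hypothesis S_unit : isomorphic (S ord0) tens_unit.
Hypothesis S_schur : forall i, schur (S i).
Hypothesis C_semisimple : semisimple_category C.
Hypothesis V_expand : forall k j i (f : hom (S i) (tens (S k) (S j))),
  \sum_(u < N k j i) V u • ((V u)^† • f) = f.
Hypothesis N_unit : forall k j, N k j ord0 = (k == dual j).
Hypothesis dualK : involutive dual.

(** By [N_unit], [Hom(1, S k ⊗ S j)] is a line if [j = dual k], and zero otherwise. *)
Lemma hom_unit_tens k j (f g : hom tens_unit (tens (S k) (S j))) :
  f <> 0 -> j = dual k /\ exists a, g = a *: f.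
Proof.
have [h [h' [h'h hh']]] := S_unit.
have [kj|kj] := eqVneq k (dual j); last first.
  have f0 : f = 0.
    rewrite -[f]comp_idr -hh' compA -(V_expand (f • h)).
    have := N_unit k j; rewrite (negPf kj) /= => N0.
    rewrite big1 ?comp0l // => u _.
    by exfalso; move: u; rewrite N0 => -[].
  by move=> /(_ f0).
move=> f0; split; first by rewrite kj dualK.
have N1 : N k j ord0 = 1%N by rewrite N_unit kj eqxx.
have [u _] : exists u : 'I_(N k j ord0), true by rewrite N1; exists ord0.
have exp (e : hom tens_unit (tens (S k) (S j))) : exists c, e • h = c *: V u.
  exists (scal ((V u)^† • (e • h))).
  rewrite -[LHS]V_expand (bigD1 u) //= big1 ?addr0 => [|v vu].
    by rewrite {1}(scalE (S_schur ord0) ((V u)^† • (e • h))) compZr comp_idr.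
  case/eqP: vu; apply/val_inj; case: u v => u hu [v hv] /=.
  by move: hu hv; rewrite N1; case: u v => [|u] [|v].
have [c fc] := exp f; have [c' gc'] := exp g.
have c0 : c != 0.
  apply/eqP=> c0; apply: f0.
  by rewrite -[f]comp_idr -hh' compA fc c0 scale0r comp0l.
exists (c' / c).
rewrite -[g]comp_idr -[f]comp_idr -hh' !compA fc gc' -compZl scalerA.
by rewrite divfK.
Qed.

(** Composing with [coev] is injective on arrows out of [Y], so each simple summand of [Y] yields a
    nonzero arrow from the unit and is isomorphic to [S (dual k)]. Two summands would give
    independent vectors in a line, and none would make the identity of [S k] vanish; hence [Y] is
    [S (dual k)] up to isomorphism. *)
Lemma left_dual_simple k Y : left_dual (S k) Y -> left_dual (S k) (S (dual k)).
Proof.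
move=> hY; have [ev [coev [zz1 zz2]]] := hY.
have [S_simple S_inj S_all] := S_reps.
have [m [F [F_simple [inj [prj [prj_inj prj_inj0 sum_id]]]]]] := C_semisimple Y.
have comp_iso t : exists (f : hom (F t) (S (dual k))), is_iso f /\
    S k ◁ (f • prj t) • coev <> 0.
  have [j [f [g [gf fg]]]] := S_all _ (F_simple t).
  have nz : S k ◁ (f • prj t) • coev <> 0.
    move/(coev_faithful zz2)/(congr1 (fun h => g • h • inj t)).
    rewrite compA gf comp_idl prj_inj comp0r comp0l.
    by case: (F_simple t).
  have [jk _] := hom_unit_tens 0 nz.
  by subst j; exists f; split=> //; exists g.
case: m F F_simple inj prj prj_inj prj_inj0 sum_id comp_iso => [|m] F F_simple inj prj
  prj_inj prj_inj0 sum_id comp_iso.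
  case: (S_simple k) => + _; case.
  rewrite big_ord0 in sum_id.
  have [g [gl lg]] := lunit_iso (S k).
  rewrite -lg -zz1 -[coev]comp_idl -[idm (tens (S k) Y)]tensm_id -sum_id whl0 comp0l whr0.
  by rewrite !comp0r comp0l.
case: m F F_simple inj prj prj_inj prj_inj0 sum_id comp_iso => [|m] F F_simple inj prj
  prj_inj prj_inj0 sum_id comp_iso.
  have [f [[g [gf fg]] _]] := comp_iso ord0.
  rewrite big_ord1 in sum_id.
  apply: (left_dual_iso (f := f • prj ord0) (g := inj ord0 • g)) hY.
    by rewrite !compA -(compA _ g f) gf comp_idr.
  by rewrite !compA -(compA _ (prj _) (inj _)) prj_inj comp_idr.
have [f [[g [gf fg]] nzf]] := comp_iso ord0.
have [f' [[g' [gf' fg']] nzf']] := comp_iso ord_max.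
have [_ [a fa]] := hom_unit_tens (S k ◁ (f' • prj ord_max) • coev) nzf.
have : f' • prj ord_max - a *: (f • prj ord0) = 0.
  apply: (coev_faithful zz2).
  by rewrite -scaleNr whlD compDl whlZ compZl fa -scalerDl subrr scale0r.
move/(congr1 (fun h => g' • h • inj ord_max)).
rewrite compDr compDl comp0r comp0l -scaleN1r !compZr !compZl compA gf' comp_idl prj_inj.
rewrite !compA -!(compA _ (prj ord0)) prj_inj0 // !comp0r !scaler0 addr0.
by case: (F_simple ord_max).
Qed.

End SimpleDuals.

(** * Fusion rings *)

Section FusionRing.
Variables (n : nat) (A : fusion_ring n).
Implicit Types i j k l : 'I_n.+1.
Local Notation N := (fusion_coef A).
Local Notation dual := (fusion_dual A).
Local Notation b := (fusion_basis A).

Lemma fusion_basis_inj (c c' : 'I_n.+1 -> nat) :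
  \sum_i b i *+ c i = \sum_i b i *+ c' i -> c =1 c'.
Proof.
have [a [_ aU]] := fusion_basisP (\sum_i b i *+ c i).
have e (c0 : 'I_n.+1 -> nat) :
    \sum_i b i *+ c0 i = \sum_i b i *~ [ffun j => Posz (c0 j)] i.
  by apply: eq_bigr => i _; rewrite ffunE.
move=> cc' i.
have h1 := aU _ (e c); have h2 := aU [ffun j => Posz (c' j)]; rewrite cc' e in h2.
have := h1; rewrite (h2 erefl) => /ffunP /(_ i); rewrite !ffunE.
by case.
Qed.

Lemma fusion_assoc k j l i :
  (\sum_m N k j m * N m l i = \sum_m N j l m * N k m i)%N.
Proof.
apply: (fusion_basis_inj (c := fun i => (\sum_m N k j m * N m l i)%N)
  (c' := fun i => (\sum_m N j l m * N k m i)%N)).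
transitivity (b k * b j * b l).
  rewrite fusion_rule mulr_suml.
  under [RHS]eq_bigr => m _ do rewrite mulrnAl fusion_rule -sumrMnl.
  rewrite exchange_big; apply: eq_bigr => i0 _ /=.
  by rewrite -sumrMnr; apply: eq_bigr => m _; rewrite -mulrnA mulnC.
rewrite -mulrA fusion_rule mulr_sumr.
under eq_bigr => m _ do rewrite mulrnAr fusion_rule -sumrMnl.
rewrite exchange_big; apply: eq_bigr => i0 _ /=.
by rewrite -sumrMnr; apply: eq_bigr => m _; rewrite -mulrnA mulnC.
Qed.

(** Both sides are the coefficient of the unit in [x_k x_j x_l]. *)
Lemma fusion_coef_cycle k j l : N k j (dual l) = N j l (dual k).
Proof.
have := fusion_assoc k j l ord0.
rewrite (bigD1 (dual l)) //= big1 ?addn0 => [|m ml]; last first.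
  by rewrite fusion_coef_unit (negPf ml) muln0.
rewrite (bigD1 (dual k)) //= big1 ?addn0 => [|m mk]; last first.
  rewrite fusion_coef_unit (_ : (k == dual m) = false) ?muln0 //.
  by apply: contraNF mk => /eqP->; rewrite fusion_dualK.
by rewrite !fusion_coef_unit fusion_dualK !eqxx !muln1.
Qed.

Lemma fusion_coef_rotate k j i : N k j i = N j (dual i) (dual k).
Proof. by rewrite -fusion_coef_cycle fusion_dualK. Qed.

Lemma fusion_coef_dual k j i : N k j i = N (dual k) i j.
Proof. by rewrite 2!fusion_coef_rotate -fusion_dualM !fusion_dualK. Qed.

(** Once [j] is moved across as [j^*], this is associativity of [x_{j^*} x_i x_d]. *)
Lemma fusion_coef_exchange i j d d' :
  (\sum_m N i d m * N j d' m = \sum_k N j k i * N k d d')%N.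
Proof.
under eq_bigr => m _ do rewrite (fusion_coef_dual j).
under [RHS]eq_bigr => k _ do rewrite (fusion_coef_dual j).
by rewrite fusion_assoc.
Qed.

End FusionRing.

Definition unitary_dagger (R : realType) (C : tens_category R[i])
    (U : unitary_structure C) : dagger_structure (K := R[i]) C.
Proof.
refine (@Dagger _ C (@star R C U) _ _ _ _ _ _ _ _ _ _ _).
- exact: star_antilinear.
- exact: starK.
- exact: star_comp.
- move=> X Y f ff0; apply: (hnorm0_eq0 (u := U)); apply/eqP.
  have h0 : hnorm U (0 : hom X X) = 0.
    have := hnormZ U 0 (0 : hom X X).
    by rewrite scale0r normr0 mul0r => -[].
  by rewrite -[_ == 0](@sqrf_eq0 R) -hnorm_star ff0 h0.
- exact: star_positive.
- exact: star_tensm.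
- exact: assoc_unitary.
- by move=> X; case: (lunit_unitary U X).
- by move=> X; case: (lunit_unitary U X).
- by move=> X; case: (runit_unitary U X).
- by move=> X; case: (runit_unitary U X).
Defined.

(** * Operator norms *)

Section OperatorNorm.
Variable R : realType.
Local Open Scope complex_scope.
Local Open Scope sesquilinear_scope.

Definition absC (z : R[i]) : R := complex.Re `|z|.

Lemma absCE z : `|z| = (absC z)%:C.
Proof. by rewrite RRe_real // normr_real. Qed.

Lemma absC_ge0 z : 0 <= absC z.
Proof. by rewrite -lecR -absCE rmorph0. Qed.

Lemma absC_real (r : R) : 0 <= r -> absC r%:C = r.
Proof. by move=> r0; rewrite /absC ger0_norm ?lecR. Qed.

Lemma absCD z w : absC (z + w) <= absC z + absC w.
Proof. by rewrite -lecR rmorphD /= -!absCE ler_normD. Qed.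

Lemma absCM z w : absC (z * w) = absC z * absC w.
Proof.
by apply: (@complexI R); rewrite rmorphM /= -!absCE normrM.
Qed.

Lemma absC_sum m (F : 'I_m -> R[i]) : absC (\sum_i F i) <= \sum_i absC (F i).
Proof.
elim/big_ind2: _ => [|z a w b za wb|//]; first by rewrite /absC normr0.
by rewrite (le_trans (absCD _ _)) // lerD.
Qed.

Lemma l2norm_absC m (u : 'cV[R[i]]_m) : l2norm u = Num.sqrt (\sum_i absC (u i 0) ^+ 2).
Proof.
rewrite /l2norm; congr Num.sqrt; rewrite mxE.
have -> : \sum_j u^t* 0 j * u j 0 = (\sum_j absC (u j 0) ^+ 2)%:C.
  rewrite rmorph_sum; apply: eq_bigr => j _ /=.
  by rewrite !mxE rmorphXn /= -absCE normCKC.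
by [].
Qed.

(* The Schur test, with the positive vector [d] as weight. *)
Lemma opnorm_positive_eigenvector m (M : 'I_m.+1 -> 'I_m.+1 -> R) (d : 'I_m.+1 -> R) (l : R) :
  (forall i j, 0 <= M i j) -> (forall i, 0 < d i) -> 0 <= l ->
  (forall j, \sum_i M i j * d i = l * d j) ->
  (forall i, \sum_j M i j * d j = l * d i) ->
  opnorm (\matrix_(i, j) (M i j)%:C) = l.
Proof.
move=> M0 d0 l0 eigl eigr; set T := \matrix_(i, j) _.
have schur_test (u : 'cV[R[i]]_m.+1) : l2norm (T *m u) <= l * l2norm u.
  pose a i := absC (u i 0).
  have a0 i : 0 <= a i := absC_ge0 _.
  have le1 i : absC ((T *m u) i 0) <= \sum_j M i j * a j.
    rewrite mxE (le_trans (absC_sum _)) //; apply: ler_sum => j _.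
    by rewrite mxE absCM absC_real.
  have amgm j k : a j * a k <= 2^-1 * (a j ^+ 2 * d k / d j + a k ^+ 2 * d j / d k).
    have dj := d0 j; have dk := d0 k.
    rewrite -subr_ge0.
    rewrite (_ : _ - _ = (a j * d k - a k * d j) ^+ 2 / (2 * d j * d k)); last first.
      by field; rewrite !lt0r_neq0.
    by rewrite divr_ge0 ?sqr_ge0 // !mulr_ge0 // ltW.
  (* Cauchy-Schwarz in row [i] with weights [M i j * d j], whose sum is given by [eigr]. *)
  have le2 i : (\sum_j M i j * a j) ^+ 2 <= l * d i * \sum_j M i j * (a j ^+ 2 / d j).
    rewrite expr2 big_distrlr /=.
    pose h j k := M i j * M i k * (a j ^+ 2 * d k / d j).
    apply: (@le_trans _ _ (\sum_j \sum_k 2^-1 * (h j k + h k j))).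
      apply: ler_sum => j _; apply: ler_sum => k _.
      rewrite mulrACA /h [M i k * M i j]mulrC -mulrDr [leRHS]mulrCA.
      by rewrite ler_wpM2l ?mulr_ge0 //; exact: amgm.
    have sw : \sum_j \sum_k h k j = \sum_j \sum_k h j k by rewrite exchange_big.
    have -> : \sum_j \sum_k 2^-1 * (h j k + h k j) = \sum_j \sum_k h j k.
      transitivity (2^-1 * (\sum_j \sum_k h j k + \sum_j \sum_k h k j)).
        rewrite -big_split mulr_sumr; apply: eq_bigr => j _ /=.
        by rewrite -big_split mulr_sumr.
      by rewrite sw; move: (\sum_j _) => x; field.
    rewrite -(eigr i) mulr_sumr le_eqVlt; apply/orP; left; apply/eqP.
    apply: eq_bigr => j _; rewrite mulr_suml; apply: eq_bigr => k _.
    by rewrite /h; field; rewrite lt0r_neq0.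
  rewrite !l2norm_absC -[l in l * _]ger0_norm // -sqrtr_sqr -sqrtrM ?sqr_ge0 //.
  apply: ler_wsqrtr.
  apply: (@le_trans _ _ (\sum_i l * d i * \sum_j M i j * (a j ^+ 2 / d j))).
    apply: ler_sum => i _; apply: le_trans (le2 i).
    by rewrite ler_sqr ?nnegrE ?absC_ge0 // sumr_ge0 // => j _; rewrite mulr_ge0.
  rewrite le_eqVlt; apply/orP; left; apply/eqP.
  under eq_bigr do rewrite mulr_sumr.
  rewrite exchange_big mulr_sumr; apply: eq_bigr => j _ /=.
  transitivity (l * (a j ^+ 2 / d j) * \sum_i M i j * d i).
    by rewrite mulr_sumr; apply: eq_bigr => i _; ring.
  by rewrite eigl /a; field; rewrite lt0r_neq0.
(* The normalised vector [d] attains the bound. *)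
pose rho := Num.sqrt (\sum_i d i ^+ 2).
have rho0 : 0 < rho.
  rewrite sqrtr_gt0 (lt_le_trans (_ : 0 < d ord0 ^+ 2)) ?exprn_gt0 //.
  by rewrite (bigD1 ord0) //= lerDl sumr_ge0 // => i _; rewrite sqr_ge0.
pose u : 'cV[R[i]]_m.+1 := \col_i (d i / rho)%:C.
have dr0 i : 0 <= d i / rho by rewrite divr_ge0 // ltW.
have u1 : l2norm u = 1.
  rewrite l2norm_absC; under eq_bigr do rewrite mxE absC_real // expr_div_n.
  rewrite -mulr_suml -[X in X / _]sqr_sqrtr ?sumr_ge0 // => [|i _]; last by rewrite sqr_ge0.
  by rewrite -/rho mulfV ?sqrtr1 // expf_neq0 // lt0r_neq0.
have Tu : l2norm (T *m u) = l.
  have -> : T *m u = l%:C *: u.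
    apply/colP=> i; rewrite !mxE -rmorphM /= mulrA -eigr mulr_suml rmorph_sum.
    by apply: eq_bigr => j _; rewrite !mxE -rmorphM /= mulrA.
  rewrite l2norm_absC; under eq_bigr do rewrite mxE absCM absC_real // exprMn.
  rewrite -mulr_sumr sqrtrM ?sqr_ge0 // -l2norm_absC u1 mulr1 sqrtr_sqr ger0_norm //.
rewrite /opnorm; apply/le_anti/andP; split.
  apply: ge_sup; first by exists l, u; rewrite /= ?u1.
  move=> _ [w /= w1 <-]; apply: le_trans (schur_test w) _.
  by rewrite -[leRHS]mulr1 ler_wpM2l.
apply: ub_le_sup; last by exists u; rewrite /= ?u1.
exists l => _ [w /= w1 <-]; apply: le_trans (schur_test w) _.
by rewrite -[leRHS]mulr1 ler_wpM2l.
Qed.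

End OperatorNorm.

(** * Positivity *)

(** What the final computation takes from the category: a positive character [q] of the fusion ring
    and a positive kernel. *)
Lemma categorified_positivity (K : numClosedFieldType) (C : tens_category K)
    (D : dagger_structure C) (n : nat) (A : fusion_ring n) :
  is_fusion_category C -> grothendieck_iso C A ->
  exists q : 'I_n.+1 -> K,
    [/\ forall i, 0 < q i,
        forall k j, q k * q j = \sum_i (fusion_coef A k j i)%:R * q i
      & forall z : 'I_n.+1 * 'I_n.+1 * 'I_n.+1 -> K,
        0 <= \sum_p \sum_p' z p * (z p')^* *
          (\sum_k (fusion_coef A p'.1.1 k p.1.1 * fusion_coef A k p.1.2 p'.1.2
                   * fusion_coef A k p.2 p'.2)%:R / q k)].
Proof.
move=> [C_abelian [C_ss _] C_rigid _] [S [S_reps S_unit S_mult]].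
have [S_simple S_inj _] := S_reps.
have S_schur i : schur (S i) := simple_schur C_abelian (S_simple i).
have S_neq i j : i != j -> forall f : hom (S i) (S j), f = 0.
  move=> /eqP ij f; have [//|f_iso] := simple_hom C_abelian f (S_simple i) (S_simple j).
  by case: ij; apply: S_inj; exists f.
have unit_schur : schur (tens_unit : C).
  by have [f f_iso] := S_unit; apply: schur_iso f_iso (S_schur _).
have onb k j i : exists V : 'I_(fusion_coef A k j i) -> hom (S i) (tens (S k) (S j)),
    (forall u v, dag D (V u) • V v = (u == v)%:R *: idm (S i)) /\
    (forall f : hom (S i) (tens (S k) (S j)), \sum_u V u • (dag D (V u) • f) = f).
  have [inj [prj [prj_inj prj_inj0 sum_id]]] := S_mult k j.
  exact: (@simple_onb _ _ D _ _ S_schur S_neq _ _ _ _ prj_inj prj_inj0 sum_id i).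
pose V k j i := projT1 (cid (onb k j i)).
have V_orth k j i (u v : 'I_(fusion_coef A k j i)) :
    dag D (V k j i u) • V k j i v = (u == v)%:R *: idm (S i).
  by rewrite /V; case: (cid _) => ? [] /=.
have V_expand k j i (f : hom (S i) (tens (S k) (S j))) :
    \sum_u V k j i u • (dag D (V k j i u) • f) = f.
  by rewrite /V; case: (cid _) => ? [] /=.
have V_complete k j : \sum_i \sum_(u < fusion_coef A k j i) V k j i u • dag D (V k j i u)
    = idm (tens (S k) (S j)).
  have [inj [prj [prj_inj prj_inj0 sum_id]]] := S_mult k j.
  exact: (onb_complete (D := D) S_neq sum_id (V_expand k j)).
have S_dual k : left_dual (S k) (S (fusion_dual A k)).
  have [[Y hY] _] := C_rigid (S k).
  apply: (left_dual_simple (D := D) S_reps S_unit S_schur C_ss V_expand) hY => [k' j|].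
    exact: fusion_coef_unit.
  exact: fusion_dualK.
have S_pairs k := left_dual_pair D unit_schur (S_schur k).1 (S_dual k).
pose r k := projT1 (cid (S_pairs k)).
pose s k := projT1 (cid (projT2 (cid (S_pairs k)))).
pose q k := projT1 (cid (projT2 (cid (projT2 (cid (S_pairs k)))))).
have S_pair k : dual_pair D (r k) (s k) (q k) :=
  projT2 (cid (projT2 (cid (projT2 (cid (S_pairs k)))))).
exists q; split=> [i|k j|z].
- exact: dual_gt0 (S_pair i).
- exact: (qd_mul unit_schur S_schur S_neq S_pair V_orth V_complete).
apply: (gram_psd unit_schur S_schur S_neq S_pair V_orth V_complete).
  by move=> *; apply: fusion_coef_dual.
by move=> *; apply: fusion_coef_exchange.
Qed.

Section Final.
Local Open Scope complex_scope.
Local Open Scope sesquilinear_scope.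

Lemma quadratic_formE (K : numClosedFieldType) m (M : 'M[K]_m) (u : 'cV[K]_m) :
  (u^t* *m M *m u) 0 0 = \sum_i \sum_j (u i 0)^* * M i j * u j 0.
Proof.
rewrite mxE exchange_big; apply: eq_bigr => j _ /=.
by rewrite mxE mulr_suml; apply: eq_bigr => i _; rewrite !mxE.
Qed.

Lemma opnorm_fusion_mx (R : realType) (n : nat) (A : fusion_ring n) (q : 'I_n.+1 -> R[i]) k :
  (forall i, 0 < q i) ->
  (forall k j, q k * q j = \sum_i (fusion_coef A k j i)%:R * q i) ->
  (opnorm (fusion_mx R A k))%:C = q k.
Proof.
move=> q0 qM; pose d i := complex.Re (q i).
have qd i : q i = (d i)%:C by rewrite RRe_real // gtr0_real.
have d0 i : 0 < d i by rewrite -ltcR -qd rmorph0.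
have dM k' j : d k' * d j = \sum_i (fusion_coef A k' j i)%:R * d i.
  apply: (@complexI R); rewrite rmorphM /= -!qd qM rmorph_sum; apply: eq_bigr => i _ /=.
  by rewrite qd rmorphM /= rmorph_nat.
(* The transpose of [M_k] is the matrix of the dual index, so [d] is an eigenvector of both, with
   eigenvalues [d k] and [d (fusion_dual A k)]; pairing with [d] itself shows that they agree. *)
have d_dual : d (fusion_dual A k) = d k.
  have Q0 : 0 < \sum_i d i * d i.
    rewrite (bigD1 ord0) //= ltr_wpDr ?mulr_gt0 // sumr_ge0 // => i _.
    by rewrite mulr_ge0 // ltW.
  apply: (mulIf (lt0r_neq0 Q0)); rewrite !mulr_sumr.
  transitivity (\sum_j \sum_i (fusion_coef A (fusion_dual A k) j i)%:R * d i * d j).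
    by apply: eq_bigr => j _; rewrite mulrA dM mulr_suml.
  rewrite exchange_big; apply: eq_bigr => i _ /=.
  rewrite mulrA dM mulr_suml; apply: eq_bigr => j _.
  by rewrite -fusion_coef_dual; ring.
have -> : fusion_mx R A k = \matrix_(i, j) ((fusion_coef A k j i)%:R : R)%:C.
  by apply/matrixP => i j; rewrite !mxE rmorph_nat.
rewrite (opnorm_positive_eigenvector (d := d) (l := d k)) -?qd //.
  exact: ltW.
move=> i; rewrite -d_dual dM.
by apply: eq_bigr => j _; rewrite fusion_coef_dual.
Qed.

End Final.

Local Open Scope complex_scope.
Local Open Scope sesquilinear_scope.

Theorem theorem1p2 (R : realType) (n : nat) (A : fusion_ring n)
    (hA : unitary_categorification R A) (v : 'cV[R[i]]_n.+1) :
  possemidef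
    (\sum_(k < n.+1)
       ((v^t* *m fusion_mx R A k *m v) 0 0 / (opnorm (fusion_mx R A k))%:C)
       *: (fusion_mx R A k *t fusion_mx R A k)).
Proof.
have [C CA] := hA.
have [q [q0 qM gram]] :=
  categorified_positivity (unitary_dagger (ufc_unitary C)) (ufc_fusion C) CA.
move=> u.
pose w (c d : 'I_n.+1) := u (mxtens_index (c, d)) 0.
pose z (p : 'I_n.+1 * 'I_n.+1 * 'I_n.+1) := v (fusion_dual A p.1.1) 0 * w p.1.2 p.2.
apply: le_trans (gram z) _; rewrite le_eqVlt; apply/orP; left; apply/eqP.
pose N := fusion_coef A; pose dl := fusion_dual A.
have dlK : involutive dl := @fusion_dualK n A.
pose T := \sum_(x : 'I_n.+1 * 'I_n.+1) \sum_(x' : 'I_n.+1 * 'I_n.+1) \sum_k \sum_i \sum_j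
  v (dl i) 0 * (v (dl j) 0)^* * (w x.1 x.2 * (w x'.1 x'.2)^* ) *
    ((N j k i * N k x.1 x'.1 * N k x.2 x'.2)%:R / q k).
transitivity T.
  pose h (y : 'I_n.+1 * 'I_n.+1 * 'I_n.+1) := (y.2, y.1.1, y.1.2).
  have h_bij : bijective h.
    by exists (fun p => (p.1.2, p.2, p.1.1)) => [[[c d] i]|[[i c] d]].
  rewrite (reindex h) /=; last exact: onW_bij.
  rewrite -(pair_bigA _ (fun x i => \sum_p' z (h (x, i)) * (z p')^* *
    (\sum_k (N p'.1.1 k i * N k x.1 p'.1.2 * N k x.2 p'.2)%:R / q k))) /=.
  apply: eq_bigr => x _.
  under eq_bigr => i _.
    rewrite (reindex h) /=; last exact: onW_bij.
    rewrite -(pair_bigA _ (fun x' j => z (h (x, i)) * (z (h (x', j)))^* *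
      (\sum_k (N j k i * N k x.1 x'.1 * N k x.2 x'.2)%:R / q k))) /=.
    over.
  rewrite exchange_big; apply: eq_bigr => x' _ /=.
  under eq_bigr => i _.
    under eq_bigr => j _ do rewrite mulr_sumr.
    rewrite exchange_big.
    over.
  rewrite exchange_big; apply: eq_bigr => k _ /=.
  apply: eq_bigr => i _; apply: eq_bigr => j _.
  by rewrite /z /h /= -/dl rmorphM /=; ring.
rewrite quadratic_formE.
have mx_bij : bijective (@mxtens_index n.+1 n.+1).
  exists (@mxtens_unindex n.+1 n.+1); [exact: mxtens_indexK | exact: mxtens_unindexK].
rewrite [RHS](reindex (@mxtens_index n.+1 n.+1)) /=; last exact: onW_bij.
under [RHS]eq_bigr => x' _.
  rewrite (reindex (@mxtens_index n.+1 n.+1)) /=; last exact: onW_bij.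
  over.
rewrite [RHS]exchange_big; apply: eq_bigr => x _ /=; apply: eq_bigr => x' _.
rewrite summxE mulr_sumr mulr_suml; apply: eq_bigr => k _.
have dl_bij : bijective dl := inv_bij dlK.
rewrite mxE (opnorm_fusion_mx _ q0 qM) quadratic_formE.
rewrite [X in X / _](reindex dl) /=; last exact: onW_bij.
under [X in X / _]eq_bigr => j _.
  rewrite (reindex dl) /=; last exact: onW_bij.
  over.
rewrite exchange_big !mulr_suml mulr_sumr mulr_suml; apply: eq_bigr => i _ /=.
rewrite !mulr_suml mulr_sumr mulr_suml; apply: eq_bigr => j _.
case: x x' => [c d] [c' d'] /=; rewrite tensmxE !mxE /N /w.
rewrite (@fusion_coef_rotate n A i k j) -/dl !natrM.
by ring.
Qed.
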